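(* Suppose that the following two assumptions hold for a constant $C_{\text{inv}}>0$, independent of the element diameters. (i) For each element $\Omega^e\in\mathcal{M}$, with diameter $h_e$, $$\left(\nabla\cdot(2\nu\nabla^s\mathbf{v}^h),\nabla\cdot(2\nu\nabla^s\mathbf{v}^h)\right)_{\Omega^e}\le\frac{C_{\text{inv}}}{h_e^2}\left(\nu\nabla^s\mathbf{v}^h,\nu\nabla^s\mathbf{v}^h\right)_{\Omega^e}\qquad\text{for all }\mathbf{v}^h\in\mathcal{V}^h.$$ (ii) For each element $\Omega^e\in\mathcal{M}$, $\tau_{\text{M}}\le\dfrac{h_e^2}{C_{\text{inv}}\nu}$ on $\Omega^e$. Let $(\mathbf{u}^h,p^h)\in\mathcal{V}^h_T\times\mathcal{Q}^h_T$ and $(\mathbf{u}',p')\in\mathcal{V}'_T\times\mathcal{Q}'_T$ be a solution of the semi-discrete Problem $(V^h)$ described in the context. Then, for a.e. $t\in(0,T)$, the kinetic energy evolves as $$\frac{d}{dt}\left(\frac12\|\mathbf{u}^h+\mathbf{u}'\|^2\right)\le(\mathbf{f},\mathbf{u}^h+\mathbf{u}')-\frac12k(\mathbf{u}^h,\mathbf{u}^h)-(\tau_{\text{C}}\nabla\cdot\mathbf{u}^h,\nabla\cdot\mathbf{u}^h)-\frac12(\tau_{\text{M}}^{-1}\mathbf{u}',\mathbf{u}').$$ In particular, if $\mathbf{f}=\mathbf{0}$, the kinetic energy $\frac12\|\mathbf{u}^h+\mathbf{u}'\|^2$ decays (is non-increasing) in time.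
   Context: Let $\Omega\subset\mathbb{R}^d$ be a bounded domain, $T>0$, $\nu>0$ a constant (kinematic viscosity), and $\mathbf{f}:\Omega\times(0,T)\to\mathbb{R}^d$ a source term. $(\cdot,\cdot)$ and $\|\cdot\|$ denote the $L^2(\Omega)$ inner product and norm, $(\cdot,\cdot)_{\Omega^e}$ the $L^2(\Omega^e)$ inner product, and $\nabla^s$ is the symmetrized gradient. Let $\mathcal{V}=(H^1_0(\Omega))^d$ and $\mathcal{Q}=L^2_0(\Omega)$ (mean-zero $L^2$ functions). Let $\mathcal{V}^h\subset\mathcal{V}$ and $\mathcal{Q}^h\subset\mathcal{Q}\cap H^1(\Omega)$ be finite-dimensional (the coarse-scale velocity and pressure spaces), forming an inf-sup stable pair, and $\mathcal{X}^h=\mathcal{V}^h\times\mathcal{Q}^h$. They are (mapped) piecewise-polynomial or piecewise-rational spaces with respect to a mesh $\mathcal{M}$ of elements $\Omega^e$, $e=1,\dots,n_{el}$, with $\Omega=\text{int}(\cup_{e=1}^{n_{el}}\overline{\Omega^e})$. The fine-scale spaces are $\mathcal{V}'=(L^2(\Omega))^d$ and a finite-dimensional space $\mathcal{Q}'\subset H^1(\Omega)$ with $\mathcal{Q}^h\subseteq\mathcal{Q}'$. Let $\tau_{\text{C}}\ge 0$ and $\tau_{\text{M}}>0$ be stabilization parameters. Forms: $c(\mathbf{v}_1,\mathbf{v}_2,\mathbf{v}_3)=\int_\Omega(\mathbf{v}_1\cdot\nabla\mathbf{v}_2)\cdot\mathbf{v}_3\,d\Omega$, $c_{\text{cons}}(\mathbf{a},\mathbf{v}_1,\mathbf{v}_2)=-\int_\Omega\mathbf{v}_1\cdot(\mathbf{a}\cdot\nabla\mathbf{v}_2)\,d\Omega$,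 $c_{\text{skew}}=\tfrac12(c+c_{\text{cons}})$, $k(\mathbf{v}_1,\mathbf{v}_2)=\int_\Omega 2\nu\nabla^s\mathbf{v}_1:\nabla^s\mathbf{v}_2\,d\Omega$, $b(\mathbf{v},q)=\int_\Omega(\nabla\cdot\mathbf{v})\,q\,d\Omega$. Momentum residual: $\mathbf{r}_{\text{M}}=\partial_t\mathbf{u}^h+\mathbf{u}^h\cdot\nabla\mathbf{u}^h-\nabla\cdot(2\nu\nabla^s\mathbf{u}^h)+\nabla p^h-\mathbf{f}$; when it is not square-integrable, $(\mathbf{r}_{\text{M}},\mathbf{v}')$ denotes the sum of the $L^2$ inner products over the element interiors. Time-dependent spaces: $\mathcal{V}^h_T=\{\mathbf{v}\in C^0([0,T];\mathcal{V}^h):\partial_t\mathbf{v}\in L^2((0,T);\mathcal{V}^h)\}$, $\mathcal{V}'_T=\{\mathbf{v}\in C^0([0,T];\mathcal{V}'):\partial_t\mathbf{v}\in L^2((0,T);\mathcal{V}')\}$, $\mathcal{Q}^h_T=L^2((0,T);\mathcal{Q}^h)$, $\mathcal{Q}'_T=L^2((0,T);\mathcal{Q}')$. Problem $(V^h)$: find $(\mathbf{u}^h,p^h)\in\mathcal{V}^h_T\times\mathcal{Q}^h_T$ and $(\mathbf{u}',p')\in\mathcal{V}'_T\times\mathcal{Q}'_T$ with $\mathbf{u}^h(0)=\mathbf{u}^h_0$, $\mathbf{u}'(0)=\mathbf{u}'_0$ (given initial conditions), satisfying for a.e. $t\in(0,T)$ the coarse-scale problem \begin{align*} &(\partial_t\mathbf{u}^h(t),\mathbf{v}^h)+c_{\text{skew}}(\mathbf{u}^h(t),\mathbf{u}^h(t),\mathbf{v}^h)+k(\mathbf{u}^h(t),\mathbf{v}^h)-b(\mathbf{v}^h,p^h(t))+b(\mathbf{u}^h(t),q^h)\\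 &+c_{\text{cons}}(\mathbf{u}^h(t),\mathbf{u}'(t),\mathbf{v}^h)+c_{\text{skew}}(\mathbf{u}'(t),\mathbf{u}^h(t),\mathbf{v}^h)+c_{\text{cons}}(\mathbf{u}'(t),\mathbf{u}'(t),\mathbf{v}^h)+(\partial_t\mathbf{u}'(t),\mathbf{v}^h)\\ &+(\tau_{\text{C}}\nabla\cdot\mathbf{u}^h(t),\nabla\cdot\mathbf{v}^h)=(\mathbf{f}(t),\mathbf{v}^h) \end{align*} for all $(\mathbf{v}^h,q^h)\in\mathcal{X}^h$, and the fine-scale problem \begin{align*} &(\partial_t\mathbf{u}'(t),\mathbf{v}')+(\tau_{\text{M}}^{-1}\mathbf{u}'(t),\mathbf{v}')+c(\mathbf{u}'(t),\mathbf{u}^h(t),\mathbf{v}')\\ &+(\nabla p'(t),\mathbf{v}')-(\nabla q',\mathbf{u}'(t))=-(\mathbf{r}_{\text{M}}(t),\mathbf{v}') \end{align*} for all $(\mathbf{v}',q')\in\mathcal{V}'\times\mathcal{Q}'$. *)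

(* Defs.v *)
From HB Require Import structures.
From mathcomp Require Import all_boot all_order all_algebra.
From mathcomp Require Import all_classical all_reals all_analysis.
From mathcomp Require Import measurable_realfun.
From mathcomp Require mpoly.
Set Implicit Arguments.
Unset Strict Implicit.
Unset Printing Implicit Defensive.
Import Order.TTheory GRing.Theory Num.Theory.
Import numFieldNormedType.Exports.
Local Open Scope classical_set_scope.
Local Open Scope ring_scope.

Definition mx_borel_display : measure_display.
Proof. exact: default_measure_display. Qed.

Section mx_borel.
Context (R : realType) (m n : nat).
Implicit Types A : set 'M[R]_(m, n).

Let borel0 : <<s @open 'M[R]_(m, n) >> set0.
Proof. exact: sigma_algebra0. Qed.

Let borelC A : <<s open >> A -> <<s open >> (~` A).
Proof. exact: sigma_algebraC. Qed.

Let borel_bigcup (F : (set 'M[R]_(m, n))^nat) :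
  (forall i, <<s open >> (F i)) -> <<s open >> (\bigcup_i F i).
Proof. exact: sigma_algebra_bigcup. Qed.

HB.instance Definition _ := @isMeasurable.Build mx_borel_display 'M[R]_(m, n)
  <<s open >> borel0 borelC borel_bigcup.

Lemma mx_open_measurable A : open A -> measurable A.
Proof. by move=> oA; apply: sub_sigma_algebra. Qed.

Lemma measurable_mx_coord i j :
  measurable_fun [set: 'M[R]_(m, n)] (fun M : 'M[R]_(m, n) => M i j).
Proof.
apply: (measurability _ (RGenOpens.measurableE R)).
move=> _ [B [a [b ->]] <-]; rewrite setTI; apply: mx_open_measurable.
rewrite (_ : _ @^-1` _ = (fun M : 'M[R]_(m, n) => M i j) @^-1` `]a, b[%classic)//.
apply: open_comp; last exact: interval_open.
by move=> M _; exact: coord_continuous.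
Qed.

Lemma measurable_fun_mx d (T : measurableType d) (f : T -> 'M[R]_(m, n)) :
  (forall i j, measurable_fun [set: T] (fun x => f x i j)) ->
  measurable_fun [set: T] f.
Proof.
move=> mf; apply: (@measurability _ _ _ _ _ f open erefl).
move=> _ [U oU <-]; rewrite setTI.
pose box (q : 'M[rat]_(m, n) * nat) : set 'M[R]_(m, n) :=
  [set M | forall i j, `|M i j - ratr (q.1 i j)| < q.2.+1%:R^-1].
pose F q := if `[< box q `<=` U >] then f @^-1` box q else set0.
have -> : f @^-1` U = \bigcup_q F q.
  apply/seteqP; split => [x /= Ufx|x [q _]]; last first.
    by rewrite /F; case: asboolP => // + ?; exact.
  have /nbhs_ballP[e /= e0 eU] : nbhs (f x) U by exact: open_nbhs_nbhs.
  have [k ke] : exists k : nat, k.+1%:R^-1 < e / 2.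
    have e20 : 0 < e / 2 by rewrite divr_gt0.
    have [k _ /(_ k (leqnn k))] := near_infty_natSinv_lt (PosNum e20).
    by exists k.
  have Q i j : exists q : rat, `|f x i j - ratr q| < k.+1%:R^-1.
    have [q] := @rat_in_itvoo R (f x i j - k.+1%:R^-1) (f x i j + k.+1%:R^-1)
       ltac:(by rewrite ltrD2l gtrN).
    by rewrite in_itv/= => /andP[q1 q2]; exists q; rewrite distrC ltr_distl q1 q2.
  pose q := \matrix_(i, j) sval (cid (Q i j)).
  have qP i j : `|f x i j - ratr (q i j)| < k.+1%:R^-1.
    by rewrite mxE; case: cid.
  exists (q, k) => //; rewrite /F; case: asboolP => [_ i j|]; first exact: qP.
  move=> nboxU; exfalso; apply: nboxU => M Mq; apply: eU; split => // i j.
  rewrite /ball/= [X in _ < X]splitr.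
  rewrite (le_lt_trans (ler_distD (ratr (q i j)) _ _))// ltrD//.
    exact: lt_trans (qP i j) ke.
  by rewrite distrC; exact: lt_trans (Mq i j) ke.
apply: countable_bigcupT_measurable => [|q]; first exact: countableP.
rewrite /F; case: ifP => // _.
rewrite (_ : _ @^-1` _ = \bigcap_(ij : 'I_m * 'I_n)
   ((fun x => f x ij.1 ij.2) @^-1` [set r | `|r - ratr (q.1 ij.1 ij.2)| < q.2.+1%:R^-1])); last first.
  apply/seteqP; split => [x /= bx [i j] _|x bx i j]; first exact: bx.
  exact: (bx (i, j)).
apply: fin_bigcap_measurable => // -[i j] _.
rewrite -[X in measurable X]setTI; apply: mf => //=.
rewrite [X in measurable X](_ : _ = ball (ratr (q.1 i j) : R) q.2.+1%:R^-1).
  by apply: open_measurable; exact: ball_open.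
by apply/seteqP; split => r /=; rewrite distrC.
Qed.

End mx_borel.

Section lebesgue_step.
Context (R : realType) (d : nat).

Definition cons_row (z : measurableTypeR R * 'rV[R]_d) : 'rV[R]_(1 + d) :=
  row_mx (z.1)%:M z.2.

Let split_row (x : 'rV[R]_(1 + d)) : measurableTypeR R * 'rV[R]_d :=
  (lsubmx x 0 0, rsubmx x).

Let cons_rowK : cancel cons_row split_row.
Proof.
by move=> [x y]; rewrite /split_row row_mxKl row_mxKr mxE eqxx mulr1n.
Qed.

Let split_rowK : cancel split_row cons_row.
Proof.
move=> x; rewrite /cons_row/= -[RHS]hsubmxK; congr row_mx.
by rewrite [RHS]mx11_scalar.
Qed.

Lemma measurable_cons_row : measurable_fun setT cons_row.
Proof.
apply: measurable_fun_mx => i j; rewrite ord1 /cons_row.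
rewrite -(splitK j); case: (fintype.split j) => k /=.
  under eq_fun do rewrite row_mxEl ord1 mxE eqxx mulr1n.
  exact: measurable_fst.
under eq_fun do rewrite row_mxEr.
exact: measurableT_comp (measurable_mx_coord _ _) measurable_snd.
Qed.

HB.instance Definition _ :=
  isMeasurableFun.Build _ _ _ _ cons_row measurable_cons_row.

Let measurable_split_row : measurable_fun setT split_row.
Proof.
apply/prod_measurable_funP; split => /=.
  rewrite (_ : _ \o _ = fun M : 'rV[R]_(1 + d) => M 0 (lshift d 0)).
    exact: measurable_mx_coord.
  by apply/funext => x; rewrite /= mxE.
apply: measurable_fun_mx => i j /=.
under eq_fun do rewrite mxE.
exact: measurable_mx_coord.
Qed.

Context (mu : {sigma_finite_measure set 'rV[R]_d -> \bar R}).

Definition lebesgue_cons : set 'rV[R]_(1 + d) -> \bar R :=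
  pushforward (lebesgue_measure \x mu)%E cons_row.

Let lebesgue_cons0 : lebesgue_cons set0 = 0%E.
Proof. by rewrite /lebesgue_cons /pushforward preimage_set0 measure0. Qed.

Let lebesgue_cons_ge0 A : (0 <= lebesgue_cons A)%E.
Proof. exact: measure_ge0. Qed.

Let lebesgue_cons_sigma_additive : semi_sigma_additive lebesgue_cons.
Proof.
exact: measure_semi_sigma_additive.
Qed.

HB.instance Definition _ := isMeasure.Build _ _ _ lebesgue_cons
  lebesgue_cons0 lebesgue_cons_ge0 lebesgue_cons_sigma_additive.

Let lebesgue_cons_sigma_finite : sigma_finite setT lebesgue_cons.
Proof.
have /sigma_finiteP[F [TF ndF Foo]] := sigma_finiteT (@lebesgue_measure R).
have /sigma_finiteP[G [TG ndG Goo]] := sigma_finiteT mu.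
exists (fun n => split_row @^-1` (F n `*` G n)).
  rewrite -preimage_bigcup (_ : \bigcup_n _ = setT) ?preimage_setT//.
  rewrite -setXTT TF TG predeqE => -[x y]; split=> [[n _ []/= ? ?]|].
    by split; exists n.
  move=> [/= [n _ Fnx] [k _ Gky]]; exists (maxn n k) => //; split.
  - by move: x Fnx; exact/subsetPset/ndF/leq_maxl.
  - by move: y Gky; exact/subsetPset/ndG/leq_maxr.
move=> n; have [mF Fn] := Foo n; have [mG Gn] := Goo n; split.
  by rewrite -[X in measurable X]setTI; apply: measurable_split_row => //;
    exact: measurableX.
rewrite /lebesgue_cons /pushforward -comp_preimage.
rewrite (_ : split_row \o cons_row = id); last exact/funext.
by rewrite preimage_id product_measure1E// lte_mul_pinfty// ge0_fin_numE.
Qed.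

HB.instance Definition _ := Measure_isSigmaFinite.Build _ _ _ lebesgue_cons
  lebesgue_cons_sigma_finite.

End lebesgue_step.

(* Lebesgue measure on the Borel sets of R^d, as an iterated product measure *)
Fixpoint lebesgue_rV (R : realType) (d : nat) :
    {sigma_finite_measure set 'rV[R]_d -> \bar R} :=
  match d with
  | 0 => \d_(0 : 'rV[R]_0)
  | d'.+1 => lebesgue_cons (lebesgue_rV R d')
  end.

Definition rV_box (R : realType) (d : nat) (a b : 'rV[R]_d) : set 'rV[R]_d :=
  [set x | forall j, a 0 j < x 0 j <= b 0 j].

Lemma lebesgue_rV_box (R : realType) (d : nat) (a b : 'rV[R]_d) :
  (forall j, a 0 j <= b 0 j) ->
  lebesgue_rV R d (rV_box a b) = (\prod_j (b 0 j - a 0 j))%:E.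
Proof.
have rVbox_meas k (u v : 'rV[R]_k) : measurable (rV_box u v).
  rewrite (_ : rV_box u v = \bigcap_(j in [set: 'I_k])
      ((fun x : 'rV[R]_k => x 0 j) @^-1` `]u 0 j, v 0 j])); last first.
    apply/seteqP; split => [x bx j _|x bx j] /=; rewrite ?in_itv/=.
      exact: bx.
    by have := bx j I; rewrite /= in_itv.
  apply: fin_bigcap_measurable => // j _.
  by rewrite -[X in measurable X]setTI; apply: measurable_mx_coord.
elim: d a b => [|d IHd] a b ab.
  rewrite big_ord0 /= /dirac indicE mem_set//.
  by case.
change (lebesgue_cons (lebesgue_rV R d) (rV_box a b) =
  (\prod_j (b 0 j - a 0 j))%:E).
rewrite /lebesgue_cons /pushforward.
pose a' : 'rV[R]_d := \row_j a 0 (lift ord0 j).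
pose b' : 'rV[R]_d := \row_j b 0 (lift ord0 j).
have consS x y j : cons_row (x, y) 0 (lift ord0 j) = y 0 j.
  rewrite (_ : lift ord0 j = rshift 1 j); last exact/val_inj.
  by rewrite /cons_row row_mxEr.
have cons0 x (y : 'rV[R]_d) : cons_row (x, y) 0 ord0 = x.
  have -> : cons_row (x, y) 0 ord0 = cons_row (x, y) 0 (lshift d ord0).
    by congr (cons_row _ _ _); exact/val_inj.
  by rewrite /cons_row row_mxEl mxE eqxx.
rewrite (_ : _ @^-1` _ = `]a 0 ord0, b 0 ord0]%classic `*` rV_box a' b'); last first.
  apply/seteqP; split => [[x y] /= H|[x y] /= [Hx Hy] j].
    split => [|j]; first by have := H ord0; rewrite cons0 in_itv.
    by have := H (lift ord0 j); rewrite consS !mxE.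
  case: (unliftP ord0 j) => [k|] ->; last by rewrite cons0; rewrite in_itv in Hx.
  by rewrite consS; have := Hy k; rewrite !mxE.
rewrite product_measure1E//=.
have -> : lebesgue_measure (`]a 0 ord0, b 0 ord0]%classic : set R) =
    (b 0 ord0 - a 0 ord0)%:E.
  rewrite lebesgue_measure_itv/= lte_fin; case: ltP => // ba; congr EFin.
  by apply/esym/eqP; rewrite subr_eq0 eq_le ba ab.
rewrite (IHd a' b') => [|j]; last by rewrite !mxE.
rewrite big_ord_recl EFinM; congr (_ * _)%E; congr EFin.
  by apply: eq_bigr => j _; rewrite !mxE.
exact: rVbox_meas.
Qed.

Section test_functions.
Context (R : realType) (V : normedModType R).
Implicit Types (U : set V) (f : V -> R).

(* Fréchet differentiability of every iterated directional derivative, which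
   is equivalent to being of class C^oo. *)
Definition smooth_on U f :=
  forall (vs : seq V) x, U x -> differentiable (foldr (fun v g => 'D_v g) f vs) x.

Definition test_fun U f :=
  smooth_on setT f /\
  exists K, [/\ compact K, K `<=` U & forall x, ~ K x -> f x = 0].

End test_functions.

(* Sobolev spaces. The elements of L^2(A), H^1(A), etc are represented by
   functions on R^d of which only the values on A matter, and only up to
   equality almost everywhere on A. *)

Section sobolev.
Context (R : realType) (d : nat).
Local Notation mu := (@lebesgue_rV R d).
Local Notation scalar := ('rV[R]_d -> R).
Local Notation vector := ('rV[R]_d -> 'rV[R]_d).
Implicit Types (A : set 'rV[R]_d) (f g : scalar) (u v : vector).

Definition mxdot m n (M N : 'M[R]_(m, n)) : R := \sum_i \sum_j M i j * N i j.

Definition euclid_norm (x : 'rV[R]_d) : R := Num.sqrt (mxdot x x).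

Definition vcomp v (i : 'I_d) : scalar := fun x => v x 0 i.

Definition is_L2 A f :=
  measurable_fun A f /\ mu.-integrable A (fun x => (f x ^+ 2)%:E).
Definition is_L2v A v := forall i, is_L2 A (vcomp v i).

Definition L2dot A f g : R := \int[mu]_(x in A) (f x * g x).
Definition L2norm A f : R := Num.sqrt (L2dot A f f).
Definition L2dotv A u v : R := \int[mu]_(x in A) mxdot (u x) (v x).
Definition L2normv A v : R := Num.sqrt (L2dotv A v v).
Definition L2dotmx A (S1 S2 : 'rV[R]_d -> 'M[R]_d) : R :=
  \int[mu]_(x in A) mxdot (S1 x) (S2 x).

Definition is_wderiv A (j : 'I_d) f g :=
  is_L2 A g /\
  forall phi, test_fun A phi ->
    \int[mu]_(x in A) (f x * 'D_(delta_mx 0 j) phi x) =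
    - \int[mu]_(x in A) (g x * phi x).

(* The weak derivative of f in direction j on A, which is unique up to equality
   almost everywhere; zero by convention when there is none in L^2(A). *)
Definition wderiv A (j : 'I_d) f : scalar :=
  xget (fun=> 0) [set g | is_wderiv A j f g].

Definition grad A f : vector := fun x => \row_j wderiv A j f x.

(* Entry (i, j) is the derivative of component i in direction j. *)
Definition gradv A v : 'rV[R]_d -> 'M[R]_d :=
  fun x => \matrix_(i, j) wderiv A j (vcomp v i) x.

Definition symgrad A v : 'rV[R]_d -> 'M[R]_d :=
  fun x => 2^-1 *: (gradv A v x + (gradv A v x)^T).

Definition divergence A v : scalar := fun x => \tr (gradv A v x).

Definition advect A (a v : vector) : vector := fun x => a x *m (gradv A v x)^T.

Definition is_H1 A f := is_L2 A f /\ forall j, exists g, is_wderiv A j f g.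

Definition H1norm A f : R :=
  Num.sqrt (L2dot A f f + L2dotv A (grad A f) (grad A f)).
Definition H1normv A v : R :=
  Num.sqrt (L2dotv A v v + L2dotmx A (gradv A v) (gradv A v)).

(* closure in H^1(A) of the smooth functions with compact support in A *)
Definition is_H10 A f :=
  is_H1 A f /\
  forall e : R, 0 < e -> exists2 phi, test_fun A phi & H1norm A (f - phi) < e.
Definition is_H10v A v := forall i, is_H10 A (vcomp v i).

Definition is_L20 A f := is_L2 A f /\ \int[mu]_(x in A) f x = 0.

(* X is a finite-dimensional subspace of the space of (classes of) functions
   satisfying adm. *)
Definition findim_space (E : lmodType R) A (X adm : set ('rV[R]_d -> E)) :=
  exists n (phi : 'I_n -> 'rV[R]_d -> E),
    (forall i, adm (phi i)) /\
    X = [set v | adm v /\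
      exists c : 'I_n -> R, ae_eq mu A v (\sum_(i < n) c i *: phi i)].

End sobolev.

Section mesh.
Context (R : realType) (d : nat).
Local Notation mu := (@lebesgue_rV R d).
Local Notation point := 'rV[R]_d.
Implicit Types (A K O : set point) (G : point -> point).

Definition bounded_domain O :=
  [/\ open O, connected O, O !=set0 & bounded_set O].

Definition is_mesh O nel (el : 'I_nel -> set point) :=
  [/\ forall e, open (el e) /\ el e !=set0,
      trivIset setT el,
      forall e, mu (closure (el e) `\` el e) = 0%E &
      O = (\bigcup_e closure (el e))°].

Definition diam A : R :=
  sup [set r | exists x y, [/\ A x, A y & r = euclid_norm (x - y)]].

Definition smooth_map (U : set point) (F : point -> point) :=
  forall i, smooth_on U (vcomp F i).

(* G maps the element A onto the reference element K, and is the inverse of the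
   element mapping F; both are smooth up to the boundary. *)
Definition element_chart A K G :=
  [/\ open K, bounded_set K, G @` A = K &
   exists (F : point -> point) (U W : set point),
    [/\ [/\ open U, closure K `<=` U, open W & closure A `<=` W],
        smooth_map U F /\ smooth_map W G,
        (forall y, U y -> W (F y) /\ G (F y) = y) &
        (forall x, W x -> U (G x) /\ F (G x) = x)]].

Definition polyeval (p : mpoly.mpoly d R) (y : point) : R :=
  mpoly.meval (fun i => y 0 i) p.

Definition mapped_rational A K G (f : point -> R) :=
  exists p q : mpoly.mpoly d R,
    (forall y, closure K y -> polyeval q y != 0) /\
    ae_eq mu A f (fun x => polyeval p (G x) / polyeval q (G x)).

Definition piecewise_rational nel (el K : 'I_nel -> set point)
    (G : 'I_nel -> point -> point) (f : point -> R) :=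
  forall e, mapped_rational (el e) (K e) (G e) f.

End mesh.

Section bochner.
Context (R : realType) (d : nat) (E : lmodType R).
Local Notation lambda := (@lebesgue_measure R).
Local Notation field := ('rV[R]_d -> E).
Implicit Types (T : R) (N : field -> R) (X : set field) (u : R -> field).

Definition simple_fun X (s : measurableTypeR R -> field) :=
  [/\ finite_set (range s), forall y, measurable (s @^-1` [set y]) &
      forall t, X (s t)].

(* L^2((0, T); X), where N is the norm of X. Strong measurability and membership
   in X are required of the representative u at every time of (0, T); each class
   has such a representative, obtained by modification on a null set of times. *)
Definition bochner_L2 T N X u :=
  [/\ forall t, t \in `]0, T[ -> X (u t),
      exists s : nat -> measurableTypeR R -> field,
        (forall n, simple_fun X (s n)) /\
        forall t, t \in `]0, T[ -> N (u t - s n t) @[n --> \oo] --> (0 : R) &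
      lambda.-integrable `]0, T[ (fun t => (N (u t) ^+ 2)%:E)].

(* C^0([0, T]; X) *)
Definition bochner_C0 T N X u :=
  forall t, t \in `[0, T] ->
    X (u t) /\ N (u s - u t) @[s --> within `[0, T]%classic (nbhs t)] --> (0 : R).

End bochner.

Section problem.
Context (R : realType) (d : nat).
Local Notation mu := (@lebesgue_rV R d).
Local Notation lambda := (@lebesgue_measure R).
Local Notation scalar := ('rV[R]_d -> R).
Local Notation vector := ('rV[R]_d -> 'rV[R]_d).
Context (Om : set 'rV[R]_d) (T nu : R).
Implicit Types (u v w a : vector) (p q : scalar).

(* g is the weak derivative of u on (0, T), an identity between L^2(Om)^d-valued
   integrals that is tested here against the elements of L^2(Om)^d. *)
Definition weak_dt (u g : R -> vector) :=
  forall phi : R -> R, test_fun `]0, T[%classic phi ->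
  forall w, is_L2v Om w ->
    \int[lambda]_(t in `]0, T[) (derive1 phi t * L2dotv Om (u t) w) =
    - \int[lambda]_(t in `]0, T[) (phi t * L2dotv Om (g t) w).

(* g is the time derivative of u. All norms on the finite-dimensional spaces Vh
   and Q are equivalent. *)
Definition in_VhT (Vh : set vector) (u g : R -> vector) :=
  [/\ bochner_C0 T (H1normv Om) Vh u, bochner_L2 T (H1normv Om) Vh g &
      weak_dt u g].
Definition in_VfT (u g : R -> vector) :=
  [/\ bochner_C0 T (L2normv Om) (is_L2v Om) u,
      bochner_L2 T (L2normv Om) (is_L2v Om) g & weak_dt u g].
Definition in_QT (Q : set scalar) (p : R -> scalar) :=
  bochner_L2 T (@H1norm R d Om) Q p.

Definition form_c v1 v2 v3 : R := L2dotv Om (advect Om v1 v2) v3.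
Definition form_ccons a v1 v2 : R := - L2dotv Om v1 (advect Om a v2).
Definition form_cskew v1 v2 v3 : R :=
  2^-1 * (form_c v1 v2 v3 + form_ccons v1 v2 v3).
Definition form_k v1 v2 : R :=
  \int[mu]_(x in Om) (2 * nu * mxdot (symgrad Om v1 x) (symgrad Om v2 x)).
Definition form_b v q : R := L2dot Om (divergence Om v) q.

Definition inf_sup_stable (Vh : set vector) (Qh : set scalar) :=
  exists2 beta : R, 0 < beta &
  forall q, Qh q -> beta * L2norm Om q <=
    sup [set r | exists v, [/\ Vh v, H1normv Om v != 0 &
                               r = form_b v q / H1normv Om v]].

(* div (2 nu grad^s v) inside the element A: grad^s v is the restriction to A of
   the weak gradient on Om, and the outer divergence is weak on A only. *)
Definition div_stress (A : set 'rV[R]_d) v : vector := fun x =>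
  \row_i \sum_j wderiv A j (fun y => 2 * nu * symgrad Om v y i j) x.

Definition inverse_estimate (Cinv : R) nel (el : 'I_nel -> set 'rV[R]_d)
    (Vh : set vector) :=
  forall e v, Vh v ->
    L2dotv (el e) (div_stress (el e) v) (div_stress (el e) v) <=
    Cinv / diam (el e) ^+ 2 *
    L2dotmx (el e) (fun x => nu *: symgrad Om v x) (fun x => nu *: symgrad Om v x).

Definition residual A (dtu uh : vector) (ph : scalar) (f : vector) : vector :=
  fun x => dtu x + advect Om uh uh x - div_stress A uh x + grad Om ph x - f x.

(* The integral over Om is the sum over the element interiors, which cover Om up
   to a null set. *)
Definition residual_dot nel (el : 'I_nel -> set 'rV[R]_d) dtu uh ph f v : R :=
  \sum_(e < nel) L2dotv (el e) (residual (el e) dtu uh ph f) v.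

(* uh, ph are the coarse scales, uf, pf the fine scales (u' and p'), and dtuh,
   dtuf the time derivatives, all at a given time. *)
Section equations.
Context (nel : nat) (el : 'I_nel -> set 'rV[R]_d) (tauC tauM : scalar) (f : vector).
Context (uh dtuh : vector) (ph : scalar) (uf dtuf : vector) (pf : scalar).

Definition coarse_eq (vh : vector) (qh : scalar) :=
  L2dotv Om dtuh vh + form_cskew uh uh vh + form_k uh vh
  - form_b vh ph + form_b uh qh
  + form_ccons uh uf vh + form_cskew uf uh vh + form_ccons uf uf vh
  + L2dotv Om dtuf vh
  + L2dot Om (fun x => tauC x * divergence Om uh x) (divergence Om vh)
  = L2dotv Om f vh.

Definition fine_eq (vf : vector) (qf : scalar) :=
  L2dotv Om dtuf vf + L2dotv Om (fun x => (tauM x)^-1 *: uf x) vf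
  + form_c uf uh vf + L2dotv Om (grad Om pf) vf - L2dotv Om (grad Om qf) uf
  = - residual_dot el dtuh uh ph f vf.

End equations.

End problem.

(* Main.v *)
(* Testing the coarse-scale problem with (u^h, p^h) and the fine-scale problem
   with (u', p') and with (0, p^h) cancels all convective and pressure terms.
   What is left of the residual is the sum over the elements of
   (div (2 nu grad^s u^h), u'), which Young's inequality with weight tau_M,
   followed by (i) and (ii), bounds by k(u^h, u^h) / 4 + (u' / tau_M, u') / 2.

   For the time derivative, testing the weak derivative with smooth cut-offs
   gives (u(t) - u(s), w) = int_s^t (u_t, w) for each fixed w in L^2, hence
   |u(t) - u(s) - (t - s) y| <= int_s^t |u_t - y| for each fixed y. At almost
   every t, Lebesgue differentiation applies to the right-hand side for all y
   in the countable set of values of the simple functions approximating u_t, so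
   the difference quotients converge strongly to u_t(t) and E' = (u_t, u).
   When (u_t, u) <= 0 a.e., E(t) - E(s) <= (int_s^t |u_t|)^2; repeated
   bisection of the integral replaces the right-hand side by 2^-n times it, so
   that E is nonincreasing. *)

Require Import Defs.
From mathcomp Require Import all_boot all_order all_algebra.
From mathcomp Require Import all_classical all_reals all_analysis.
From mathcomp Require mpoly.
From mathcomp Require Import measurable_realfun ring lra.
Import Order.TTheory GRing.Theory Num.Theory.
Import numFieldNormedType.Exports.
Local Open Scope classical_set_scope.
Local Open Scope ring_scope.

Set Implicit Arguments.
Unset Strict Implicit.
Unset Printing Implicit Defensive.

(** * Smooth cut-offs on the line *)

Section smooth_functions.
Context {R : realType}.
Implicit Types (f g : R -> R) (n : nat) (x : R).

(** Low regularity shapes the proof in three places. In space, u' is merely square-integrable, so a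
    product such as u'·∇u^h need not be. Integrals containing it are therefore never split; they
    only cancel as equal numbers. The residual does have to be split, and for this u^h·∇u^h must lie
    in L^2, which comes from the boundedness of mapped rational functions on each element. In time,
    the weak derivative is known only through the scalar functions (u(t), w) with w fixed. Estimates
    of vector increments are obtained by choosing w to be the very increment that is estimated, so
    that no vector-valued integral is constructed. Finally, a derivative that is nonpositive almost
    everywhere does not force monotonicity, as the Cantor function shows, so decay is not read off
    E'. Instead E(b) - E(a) is exactly the integral of (u_t, (u(a) + u(b)) / 2), and replacing the
    midpoint by u(x) under the integral costs the quadratic term that the bisection removes. *)

Fixpoint diff_order n f : Prop :=
  if n is n'.+1 then (forall x, derivable f x 1) /\ diff_order n' (derive1 f)
  else True.

Lemma diff_orderW n f : diff_order n.+1 f -> diff_order n f.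
Proof.
elim: n f => // n IHn f [df dn1]; split=> //; exact: IHn.
Qed.

Lemma diff_orderP n f g : (forall x, is_derive x 1 f (g x)) ->
  diff_order n g -> diff_order n.+1 f.
Proof.
move=> df dg; split=> [x|]; first exact: ex_derive.
suff -> : derive1 f = g by [].
by apply/funext => x; rewrite derive1E derive_val.
Qed.

Lemma diff_order_is_derive n f : diff_order n.+1 f ->
  forall x, is_derive x 1 f (derive1 f x).
Proof. by move=> [df _] x; rewrite derive1E; exact: derivableP. Qed.

Lemma diff_order_cst n (r : R) : diff_order n (cst r).
Proof.
elim: n r => // n IHn r; apply: (@diff_orderP _ _ (cst 0)) => //.
Qed.

Lemma diff_orderD n f g : diff_order n f -> diff_order n g ->
  diff_order n (f \+ g).
Proof.
elim: n f g => // n IHn f g Hf Hg.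
apply: (@diff_orderP _ _ (derive1 f \+ derive1 g)) => [x|]; last first.
  by case: Hf => _ Hf; case: Hg => _ Hg; exact: IHn.
have := diff_order_is_derive Hf x; have := diff_order_is_derive Hg x => ? ?.
exact: is_deriveD.
Qed.

Lemma diff_orderM n f g : diff_order n f -> diff_order n g ->
  diff_order n (f \* g).
Proof.
elim: n f g => // n IHn f g Hf Hg.
apply: (@diff_orderP _ _ ((f \* derive1 g) \+ (g \* derive1 f))) => [x|];
  last first.
  have [_ Hf'] := Hf; have [_ Hg'] := Hg.
  by apply: diff_orderD; apply: IHn => //; exact: diff_orderW.
have := diff_order_is_derive Hf x; have := diff_order_is_derive Hg x => ? ?.
exact: is_deriveM.
Qed.

Lemma diff_order_comp n f g : diff_order n f -> diff_order n g ->
  diff_order n (f \o g).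
Proof.
elim: n f g => // n IHn f g Hf Hg.
apply: (@diff_orderP _ _ ((derive1 f \o g) \* derive1 g)) => [x|]; last first.
  have [_ Hf'] := Hf; have [_ Hg'] := Hg.
  by apply: diff_orderM => //; apply: IHn => //; exact: diff_orderW.
have dg := diff_order_is_derive Hg x.
have df := diff_order_is_derive Hf (g x).
exact: is_derive1_comp.
Qed.

Lemma diff_order_affine n (a b : R) : diff_order n (fun x => a * x + b).
Proof.
case: n => // n; apply: (@diff_orderP _ _ (cst a)) => [x|].
  apply: is_derive_eq; by rewrite addr0 /GRing.scale/= mulr1.
exact: diff_order_cst.
Qed.

(** On the line ['D_v g] is [v] times the ordinary derivative. Each directional derivative uses up
    one order of differentiability, so the induction on [vs] has to carry all orders at once. *)
Lemma diff_order_smooth f : (forall n, diff_order n f) -> smooth_on setT f.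
Proof.
move=> df vs x _; apply/derivable1_diffP.
suff H n : diff_order n (foldr (fun v g => 'D_v g) f vs) by case: (H 1).
elim: vs n => [|v vs IH] n //=.
set g := foldr _ _ _ in IH *.
have [dg _] := IH 1%N.
have -> : 'D_v g = (fun x => v * derive1 g x).
  apply/funext => y; rewrite deriveE; last exact/derivable1_diffP.
  by rewrite deriv1E.
apply: (@diff_orderM _ (cst v)); first exact: diff_order_cst.
by case: (IH n.+1).
Qed.

(** The powers of the inverse make the family of all [flat n] closed under differentiation up to
    linear combinations; [flat 0] alone is the classical exp(-1/x). *)
Definition flat n x : R := if 0 < x then x^-1 ^+ n * expR (- x^-1) else 0.

Lemma flat_ge0 n x : 0 <= flat n x.
Proof.
rewrite /flat; case: ifPn => // x0.
by rewrite mulr_ge0 ?expR_ge0// exprn_ge0// invr_ge0 ltW.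
Qed.

(** One term of the exponential series gives e^y >= y^(n+2) / (n+2)! at y = 1/x. The order 2 in [x]
    is what makes the difference quotient at the origin tend to 0. *)
Lemma flat_le n x : flat n x <= n.+2`!%:R * x ^+ 2.
Proof.
rewrite /flat; case: ifPn => [x0|_]; last by rewrite mulr_ge0// sqr_ge0.
have y0 : 0 < x^-1 by rewrite invr_gt0.
have key : x^-1 ^+ n.+2 * expR (- x^-1) <= n.+2`!%:R.
  rewrite expRN ler_pdivrMr ?expR_gt0// mulrC -ler_pdivrMr ?ltr0n ?fact_gt0//.
  by apply: le_trans (expR_ge1Dxn n.+1 (ltW y0)); rewrite lerDr.
rewrite -ler_pdivrMr ?exprn_gt0//; apply: le_trans key.
by rewrite -exprVn mulrAC -exprD addn2.
Qed.

Lemma flat_le0 n x : x <= 0 -> flat n x = 0.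
Proof. by move=> x0; rewrite /flat ltNge x0. Qed.

Lemma is_derive_inv x : x != 0 -> is_derive x 1 GRing.inv (- x^-2).
Proof.
move=> x0; have -> : GRing.inv = (fun y : R => (id y)^-1) by [].
apply: DeriveDef; first exact: derivableV.
by rewrite deriveV// derive_id /GRing.scale/= mulr1.
Qed.

Lemma is_derive_flat n x :
  is_derive x 1 (flat n) (flat n.+2 x - n%:R * flat n.+1 x).
Proof.
have [x0|x0|->] := ltgtP x 0.
- rewrite !flat_le0 ?(ltW x0)// mulr0 subr0.
  apply: (@near_eq_is_derive _ _ _ (cst 0)) => //.
  by near=> y; rewrite flat_le0// ltW//; near: y; exact: lt_nbhsl.
- apply: (@near_eq_is_derive _ _ _ (fun x => x^-1 ^+ n * expR (- x^-1))).
    by near=> y; rewrite /flat ifT//; near: y; exact: lt_nbhsr.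
  have dV := is_derive_inv (lt0r_neq0 x0).
  have dE : is_derive x 1 (fun y => expR (- y^-1)) (x^-2 * expR (- x^-1)).
    have dNV : is_derive x 1 (fun y : R => - y^-1) (x^-2).
      by apply: is_derive_eq; rewrite opprK.
    have := @is_derive1_comp _ expR (fun y : R => - y^-1) x _ _
      (is_derive_expR _) dNV.
    by rewrite mulrC.
  have dX : is_derive x 1 (fun y : R => y^-1 ^+ n) (- n%:R * x^-1 ^+ n.+1).
    have dV' : is_derive x 1 ((fun y : R => y^-1) : R^o -> R) (- x^-2) by [].
    have -> : (fun y : R => y^-1 ^+ n) = (fun y : R => y^-1) ^+ n.
      by apply/funext => y; rewrite fctE.
    apply: (is_derive_eq (is_deriveX n dV')).
    rewrite /GRing.scale/=; case: n => [|n]; first by rewrite oppr0 !mul0r.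
    by rewrite /= !exprSr; field; rewrite gt_eqF.
  have := @is_deriveM _ _ _ _ x 1 _ _ dX dE.
  move=> H; apply: is_derive_eq.
  rewrite /flat x0 /GRing.scale/= !exprSr. field. by rewrite gt_eqF.
- rewrite !flat_le0// mulr0 subr0.
  suff cv : h^-1 *: ((flat n \o shift 0) (h *: (1 : R)) - flat n 0)
      @[h --> 0^'] --> (0 : R).
    by apply: DeriveDef; [apply/cvg_ex; exists 0|exact/cvg_lim].
  apply/cvgr0Pnorm_le => e e0.
  near=> h.
  have h0 : h != 0 by near: h; exact: nbhs_dnbhs_neq.
  rewrite flat_le0// subr0 /= addr0 /GRing.scale/= mulr1 normrM.
  rewrite (ger0_norm (flat_ge0 _ _)) normfV.
  rewrite mulrC ler_pdivrMr ?normr_gt0// (le_trans (flat_le _ _))//.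
  rewrite -(@real_normK _ h) ?num_real// expr2 mulrA ler_wpM2r//.
  rewrite -ler_pdivlMl ?ltr0n ?fact_gt0//.
  near: h; apply: dnbhs0_le.
  by rewrite mulr_gt0// invr_gt0 ltr0n fact_gt0.
Unshelve. all: by end_near. Qed.

Lemma diff_order_flat n k : diff_order k (flat n).
Proof.
elim: k n => // k IH n.
apply: (diff_orderP (is_derive_flat n)).
apply: (@diff_orderD _ _ (fun x => - (n%:R * flat n.+1 x))) => //.
have -> : (fun x => - (n%:R * flat n.+1 x)) = cst (- n%:R) \* flat n.+1.
  by apply/funext => x /=; rewrite mulNr.
by apply: diff_orderM => //; exact: diff_order_cst.
Qed.

Lemma flat0_nondecreasing : {homo flat 0 : x y / x <= y}.
Proof.
move=> x y xy; rewrite {1}/flat; case: ifPn => [x0|_]; last exact: flat_ge0.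
have y0 := lt_le_trans x0 xy.
by rewrite /flat y0 !expr0 !mul1r ler_expR lerN2 lef_pV2.
Qed.

(* The inner argument is nonpositive for x <= 0 and equal to flat 0 1 for
   1 <= x, so no smooth quotient or primitive is needed. *)
Definition smooth_step x : R :=
  flat 0 (flat 0 1 - flat 0 (1 - x)) / flat 0 (flat 0 1).

Let flat_gt0 x : 0 < x -> 0 < flat 0 x.
Proof. by move=> x0; rewrite /flat x0 mul1r expR_gt0. Qed.

Lemma smooth_step_le0 x : x <= 0 -> smooth_step x = 0.
Proof.
move=> x0; rewrite /smooth_step flat_le0 ?mul0r// subr_le0.
by apply: flat0_nondecreasing; rewrite lerDl oppr_ge0.
Qed.

Lemma smooth_step_ge1 x : 1 <= x -> smooth_step x = 1.
Proof.
move=> x1; rewrite /smooth_step (@flat_le0 _ (1 - x)) ?subr_le0// subr0 divff//.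
by rewrite gt_eqF// !flat_gt0.
Qed.

Lemma smooth_step_nondecreasing : {homo smooth_step : x y / x <= y}.
Proof.
move=> x y xy; rewrite ler_wpM2r// ?invr_ge0 ?flat_ge0//.
apply: flat0_nondecreasing; rewrite lerD2l lerN2.
by rewrite flat0_nondecreasing// lerD2l lerN2.
Qed.

Lemma diff_order_smooth_step n : diff_order n smooth_step.
Proof.
pose g x := flat 0 1 - flat 0 (1 - x).
have -> : smooth_step = (flat 0 \o g) \* cst (flat 0 (flat 0 1))^-1 by [].
apply: diff_orderM; last exact: diff_order_cst.
apply: diff_order_comp; first exact: diff_order_flat.
have -> : g = (fun y => -1 * y + flat 0 1) \o (flat 0 \o (fun x => -1 * x + 1)).
  by apply/funext => x /=; rewrite /g !mulN1r addrC (addrC (- x)).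
apply: diff_order_comp; first exact: diff_order_affine.
by apply: diff_order_comp; [exact: diff_order_flat|exact: diff_order_affine].
Qed.

End smooth_functions.

(** * Weak derivatives in time *)

Section du_bois_reymond.
Context {R : realType}.
Local Notation lambda := (@lebesgue_measure R).
Implicit Types (h k : R -> R) (T s t a e x : R).

Lemma nondecreasing_derive1_ge0 (f : R -> R) x : {homo f : x y / x <= y} ->
  derivable f x 1 -> 0 <= derive1 f x.
Proof.
move=> ndf df; rewrite derive1E; apply: limr_ge => //; near=> r.
have : r != 0 by near: r; exact: nbhs_dnbhs_neq.
rewrite /= /GRing.scale/= mulr1 neq_lt => /orP[r0|r0].
  rewrite nmulr_rge0 ?invr_lt0// subr_le0 ndf// gerDr; exact: ltW.
apply: mulr_ge0; first by rewrite invr_ge0 ltW.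
rewrite subr_ge0 ndf// lerDr; exact: ltW.
Unshelve. all: by end_near. Qed.

(** Rises from 0 at [a] to 1 at [a + e], so that its derivative is a smooth probability density on
    that interval and approximates the Dirac mass at [a] as [e] tends to 0. *)
Definition ramp a e x : R := smooth_step (e^-1 * x - e^-1 * a).

Lemma diff_order_ramp n a e : diff_order n (ramp a e).
Proof.
by apply: (diff_order_comp (diff_order_smooth_step n)); exact: diff_order_affine.
Qed.

Lemma derivable_ramp a e x : derivable (ramp a e) x 1.
Proof. by have [] := diff_order_ramp 1 a e. Qed.

Lemma continuous_derive1_ramp a e : continuous (derive1 (ramp a e)).
Proof.
move=> x; have [_ [+ _]] := diff_order_ramp 2 a e => /(_ x).
by move/derivable1_diffP/differentiable_continuous.
Qed.

Lemma ramp_le a e x : 0 < e -> x <= a -> ramp a e x = 0.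
Proof.
move=> e0 xa; rewrite /ramp smooth_step_le0// -mulrBr.
by rewrite pmulr_rle0 ?invr_gt0// subr_le0.
Qed.

Lemma ramp_ge a e x : 0 < e -> a + e <= x -> ramp a e x = 1.
Proof.
move=> e0 xa; rewrite /ramp smooth_step_ge1// -mulrBr.
by rewrite mulrC ler_pdivlMr// mul1r; lra.
Qed.

Lemma ramp_nondecreasing a e : 0 < e -> {homo ramp a e : x y / x <= y}.
Proof.
move=> e0 x y xy; apply: smooth_step_nondecreasing.
by rewrite lerD2r ler_wpM2l// invr_ge0 ltW.
Qed.

Lemma ramp_itv a e x : 0 < e -> 0 <= ramp a e x <= 1.
Proof.
move=> e0; apply/andP; split.
  rewrite -(@ramp_le a e (Num.min a x))// ?ge_min ?lexx//.
  by apply: ramp_nondecreasing; rewrite // ge_min lexx orbT.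
rewrite -(@ramp_ge a e (Num.max (a + e) x))// ?le_max ?lexx//.
by apply: ramp_nondecreasing; rewrite // le_max lexx orbT.
Qed.

Lemma derive1_ramp_out a e x : 0 < e -> ~~ (a <= x <= a + e) ->
  derive1 (ramp a e) x = 0.
Proof.
move=> e0; rewrite negb_and -!ltNge => /orP[xa|xa].
  rewrite derive1E (@near_eq_derive _ _ _ _ (cst 0)) ?derive_cst//.
  by near=> y; rewrite ramp_le// ltW//; near: y; exact: lt_nbhsl.
rewrite derive1E (@near_eq_derive _ _ _ _ (cst (1 : R))) ?derive_cst//.
by near=> y; rewrite ramp_ge// ltW//; near: y; exact: lt_nbhsr.
Unshelve. all: by end_near. Qed.

Lemma integral_derive1_ramp T a e : 0 < e -> 0 <= a -> a + e <= T ->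
  \int[lambda]_(x in `[0, T]) derive1 (ramp a e) x = 1.
Proof.
move=> e0 a0 aT; rewrite /Rintegral (@continuous_FTC2 _ _ (ramp a e))//=.
- by rewrite ramp_ge// ramp_le//= oppr0 addr0.
- lra.
- by apply: continuous_subspaceT; exact: continuous_derive1_ramp.
- split=> [x _|  |]; first exact: derivable_ramp.
  + apply: cvg_at_right_filter.
    exact/differentiable_continuous/derivable1_diffP/derivable_ramp.
  + apply: cvg_at_left_filter.
    exact/differentiable_continuous/derivable1_diffP/derivable_ramp.
Qed.

(** The derivative of the ramp is nonnegative, has integral 1 and vanishes outside [[a, a + e]], so
    integrating against it is a weighted average of the values of [h] there. *)
Lemma ramp_average T h a e (c eta : R) : {within `[0, T], continuous h} ->
  0 < e -> 0 <= a -> a + e <= T ->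
  (forall x, a <= x <= a + e -> `|h x - c| <= eta) ->
  lambda.-integrable `[0, T] (EFin \o (fun x => derive1 (ramp a e) x * h x)) /\
  `|\int[lambda]_(x in `[0, T]) (derive1 (ramp a e) x * h x) - c| <= eta.
Proof.
move=> hc e0 a0 aT hle.
pose g := derive1 (ramp a e); rewrite -/g.
have gc : {within `[0, T], continuous g}.
  by apply: continuous_subspaceT; exact: continuous_derive1_ramp.
have int (q : R -> R) : {within `[0, T], continuous q} ->
    lambda.-integrable `[0, T] (EFin \o q).
  by move=> qc; apply: continuous_compact_integrable => //; exact: segment_compact.
have cM (q : R -> R) : {within `[0, T], continuous q} ->
    {within `[0, T], continuous (fun x => g x * q x)}.
  by move=> qc x; apply: cvgM; [exact: gc|exact: qc].
have cc r : {within `[0, T], continuous (cst r : R -> R)}.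
  by move=> x; exact: cvg_cst.
have igh := int _ (cM _ hc).
have mT : measurable (`[0, T]%classic : set (measurableTypeR R)) by [].
split=> //.
have g0 x : 0 <= g x.
  apply: nondecreasing_derive1_ge0; first exact: ramp_nondecreasing.
  exact: derivable_ramp.
have g1 : \int[lambda]_(x in `[0, T]) g x = 1 by exact: integral_derive1_ramp.
have -> : c = \int[lambda]_(x in `[0, T]) (g x * c).
  by rewrite RintegralZr// ?g1 ?mul1r//; exact: int.
have igc : lambda.-integrable `[0, T] (EFin \o (fun x => g x * c)).
  by apply: int; apply: cM; exact: cc.
rewrite -RintegralB//.
under eq_Rintegral do rewrite -mulrBr.
have chc : {within `[0, T], continuous (fun x => h x - c)}.
  by move=> x; apply: cvgB; [exact: hc|exact: cvg_cst].
have igch := int _ (cM _ chc).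
apply: (le_trans (le_normr_Rintegral mT igch)).
have -> : eta = \int[lambda]_(x in `[0, T]) (g x * eta).
  by rewrite RintegralZr// ?g1 ?mul1r//; exact: int.
apply: le_Rintegral => //.
- by apply: int => x; apply: cvg_norm; exact: (cM _ chc).
- by apply: int; apply: cM; exact: cc.
- move=> x _; rewrite normrM ger0_norm//.
  have [/hle|/derive1_ramp_out] := boolP (a <= x <= a + e).
    exact: ler_wpM2l.
  by rewrite -/g => -> //; rewrite !mul0r.
Qed.


Lemma test_fun_rampB T a b e : 0 < e -> 0 < a -> a <= b -> b + e < T ->
  test_fun `]0, T[%classic (ramp a e \- ramp b e).
Proof.
move=> e0 a0 ab bT; split.
  apply: diff_order_smooth => n; apply: diff_orderD; first exact: diff_order_ramp.
  have -> : (fun x => - ramp b e x) = cst (-1) \* ramp b e.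
    by apply/funext => x /=; rewrite mulN1r.
  by apply: diff_orderM; [exact: diff_order_cst|exact: diff_order_ramp].
exists `[a, b + e]%classic; split; first exact: segment_compact.
  by move=> x /=; rewrite !in_itv/= => /andP[? ?]; apply/andP; split; lra.
move=> x /=; rewrite in_itv/= => /negP; rewrite negb_and -!ltNge => /orP[xa|xb].
  by rewrite !ramp_le ?subrr//; lra.
by rewrite !ramp_ge ?subrr//; lra.
Qed.

Lemma within_continuous_dist A h s eta : {within A, continuous h} -> A s ->
  0 < eta -> exists2 delta, 0 < delta &
    forall x, A x -> `|x - s| < delta -> `|h x - h s| <= eta.
Proof.
move=> /subspace_continuousP /[apply] /cvgrPdist_le /[apply] /=.
rewrite near_withinE => -[delta /= d0 hd]; exists delta => // x Ax xs.
by rewrite distrC; apply: hd => //=; rewrite distrC.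
Qed.

Lemma Rintegral_itv_oo_cc s t k : lambda.-integrable `[s, t] (EFin \o k) ->
  \int[lambda]_(x in `]s, t[) k x = \int[lambda]_(x in `[s, t]) k x.
Proof.
move=> ik; rewrite Rintegral_itv_bndo_bndc ?Rintegral_itv_obnd_cbnd//.
- by apply: integrableS ik => //; apply: subset_itvr; rewrite bnd_simp.
- by apply: integrableS ik => //; exact: subset_itv_oo_cc.
Qed.

Lemma cvg_Rintegral_itv T s t k (phi : nat -> R -> R) : 0 <= s -> t <= T ->
  lambda.-integrable `]0, T[ (EFin \o k) ->
  (forall n, continuous (phi n)) -> (forall n x, `|phi n x| <= 1) ->
  (forall x, s < x < t -> \forall n \near \oo, phi n x = 1) ->
  (forall n x, (x <= s) || (t <= x) -> phi n x = 0) ->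
  (\int[lambda]_(x in `]0, T[) (phi n x * k x)) @[n --> \oo] -->
  \int[lambda]_(x in `]s, t[) k x.
Proof.
move=> s0 tT ik cphi phi1 phi_in phi_out.
have -> : \int[lambda]_(x in `]s, t[) k x =
    \int[lambda]_(x in `]0, T[) (k \_ `]s, t[) x.
  rewrite -Rintegral_mkcondr; congr Rintegral; rewrite setIidr// => x /=.
  by rewrite !in_itv/= => /andP[? ?]; apply/andP; lra.
have mk := measurable_int _ ik.
have mI : measurable (`]0, T[%classic : set (measurableTypeR R)) by [].
pose F n (x : measurableTypeR R) : \bar R := (phi n x * k x)%:E.
pose G (x : measurableTypeR R) : \bar R := ((k \_ `]s, t[) x)%:E.
have mF n : measurable_fun `]0, T[ (F n).
  have -> : F n = ((EFin \o phi n) \* (EFin \o k))%E.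
    by apply/funext => x; rewrite /= -EFinM.
  apply: emeasurable_funM => //; apply/measurable_EFinP.
  by apply: measurable_funTS; exact: continuous_measurable_fun.
have mG : measurable_fun `]0, T[ G.
  have -> : G = (EFin \o k) \_ `]s, t[ by rewrite /G restrict_EFin.
  by apply/measurable_restrict => //; apply: measurable_funS mk => // x [].
have ik' : lambda.-integrable `]0, T[ (abse \o (EFin \o k)).
  exact: integrable_abse.
have [] := @dominated_convergence _ _ _ lambda _ mI F G _ mF mG _ ik'.
- apply: aeW => x _; apply: cvg_EFin; first exact: nearW.
  rewrite /G patchE; case: ifPn => [|].
    rewrite inE /= in_itv/= => sxt; apply: cvg_near_cst.
    by apply: filterS (phi_in _ sxt) => n; rewrite /F /= => ->; rewrite mul1r.
  rewrite notin_setE /= in_itv/= => /negP; rewrite negb_and -!leNgt => xst.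
  by apply: cvg_near_cst; apply: nearW => n; rewrite /F /= phi_out// mul0r.
- by apply: aeW => x n _; rewrite /= lee_fin normrM ler_piMl.
- move=> iG _ cvgF; apply: fine_cvg; rewrite fineK//.
  exact: integrable_fin_num.
Qed.

(** Tested on a plateau over []s, t[], the left-hand side is a difference of two averages of [h],
    near [s] and near [t], which converge by continuity. The right-hand side converges by dominated
    convergence with majorant [|k|]. *)
Lemma du_bois_reymond T h k : {within `[0, T], continuous h} ->
  lambda.-integrable `]0, T[ (EFin \o k) ->
  (forall phi : R -> R, test_fun `]0, T[%classic phi ->
    \int[lambda]_(x in `]0, T[) (derive1 phi x * h x) =
    - \int[lambda]_(x in `]0, T[) (phi x * k x)) ->
  forall s t, 0 <= s -> s <= t -> t <= T ->
    h t - h s = \int[lambda]_(x in `]s, t[) k x.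
Proof.
move=> hc ik weak s t s0; rewrite le_eqVlt => /predU1P[->|st] tT.
  by rewrite subrr set_itv_ge ?Rintegral_set0// bnd_simp ltxx.
pose e n : R := (t - s) / 4 / n.+1%:R.
have e0 n : 0 < e n by rewrite !divr_gt0// subr_gt0.
have e4 n : e n * 4 <= t - s.
  rewrite -ler_pdivlMr// /e ler_piMr// ?divr_ge0 ?subr_ge0 ?(ltW st)//.
  by rewrite invf_le1// ler1n.
have ecvg : e n @[n --> \oo] --> (0 : R).
  rewrite -(mulr0 ((t - s) / 4)); apply: cvgM; first exact: cvg_cst.
  exact: cvg_harmonic.
(* The plateau rises on [[s + e, s + 2e]] and falls on [[t - 2e, t - e]]. Its support thus stays
   inside []0, T[] even for [s = 0] and [t = T], and the quarter in [e] keeps the two ramps from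
   overlapping. *)
pose a n := s + e n; pose b n := t - e n * 2.
pose phi n := ramp (a n) (e n) \- ramp (b n) (e n).
have mT : measurable (`[0, T]%classic : set (measurableTypeR R)) by [].
have H n : \int[lambda]_(x in `[0, T]) (derive1 (ramp (a n) (e n)) x * h x) -
    \int[lambda]_(x in `[0, T]) (derive1 (ramp (b n) (e n)) x * h x) =
    - \int[lambda]_(x in `]0, T[) (phi n x * k x).
  have e0n := e0 n; have e4n := e4 n.
  rewrite -weak; last by apply: test_fun_rampB => //; rewrite /a /b; lra.
  (* A crude bound of [h] on the whole interval: with [c := 0] and [eta := M], only the
     integrability half of [ramp_average] is used here, to join the two integrals into one. *)
  have [M hM] : exists M, forall x, 0 <= x <= T -> `|h x - 0| <= M.
    have /compact_bounded[M [_ hM]] := continuous_compact hc (@segment_compact _ 0 T).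
    exists (M + 1) => x x0T; rewrite subr0; apply: (hM (M + 1)); first by rewrite ltrDl.
    by exists x => //=; rewrite in_itv.
  have [a0 aT] : 0 <= a n /\ a n + e n <= T by rewrite /a; lra.
  have [|ia _] := ramp_average (c := 0) (eta := M) hc e0n a0 aT.
    by move=> x ?; apply: hM; lra.
  have [b0 bT] : 0 <= b n /\ b n + e n <= T by rewrite /b; lra.
  have [|ib _] := ramp_average (c := 0) (eta := M) hc e0n b0 bT.
    by move=> x ?; apply: hM; lra.
  rewrite -(RintegralB mT ia ib).
  under eq_Rintegral do rewrite -mulrBl.
  rewrite -Rintegral_itv_oo_cc; last first.
    have := integrableB mT ia ib; apply: (eq_integrable mT) => x _.
    by rewrite /= mulrBl EFinB.
  apply: eq_Rintegral => x _; congr (_ * _); rewrite !derive1E deriveB//.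
    exact: derivable_ramp.
  exact: derivable_ramp.
have cvgA (q : nat -> R) c : 0 <= c <= T ->
    (forall n, 0 <= q n /\ q n + e n <= T) ->
    (forall n x, q n <= x <= q n + e n -> `|x - c| <= e n * 2) ->
    \int[lambda]_(x in `[0, T]) (derive1 (ramp (q n) (e n)) x * h x) @[n --> \oo]
    --> h c.
  move=> c0T qT qc; apply/cvgrPdist_le => eta eta0.
  have [|del del0 hdel] := within_continuous_dist (s := c) hc _ eta0.
    by rewrite /= in_itv.
  near=> n; rewrite distrC.
  have [q0 qT'] := qT n.
  have [||||_] := @ramp_average T h (q n) (e n) (h c) eta hc => // x xq.
  apply: hdel; first by rewrite /= in_itv/=; apply/andP; lra.
  apply: le_lt_trans (qc _ _ xq) _; rewrite -ltr_pdivlMr//.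
  by near: n; apply: (cvgr_lt _ ecvg); rewrite divr_gt0.
have cvgL : (- \int[lambda]_(x in `]0, T[) (phi n x * k x)) @[n --> \oo] -->
    h s - h t.
  rewrite -(funext H); apply: cvgB; apply: cvgA => [|n|n x xq].
  - lra.
  - by have := e0 n; have := e4 n; rewrite /a; lra.
  - by have := e0 n; have := e4 n; rewrite ler_norml /a in xq *; lra.
  - lra.
  - by have := e0 n; have := e4 n; rewrite /b; lra.
  - by have := e0 n; have := e4 n; rewrite ler_norml /b in xq *; lra.
have cvgR : (\int[lambda]_(x in `]0, T[) (phi n x * k x)) @[n --> \oo] -->
    \int[lambda]_(x in `]s, t[) k x.
  apply: cvg_Rintegral_itv => // [n x|n x|x /andP[sx xt]|n x xst].
  - have cr c d : continuous (ramp c d).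
      by move=> y; exact/differentiable_continuous/derivable1_diffP/derivable_ramp.
    by apply: cvgB; exact: cr.
  - have /andP[? ?] := ramp_itv (a n) x (e0 n).
    have /andP[? ?] := ramp_itv (b n) x (e0 n).
    by rewrite ler_norml /phi /=; apply/andP; lra.
  - near=> n; have e0n := e0 n.
    have ? : e n < (x - s) / 2.
      by near: n; apply: (cvgr_lt _ ecvg); rewrite divr_gt0// subr_gt0.
    have ? : e n < (t - x) / 2.
      by near: n; apply: (cvgr_lt _ ecvg); rewrite divr_gt0// subr_gt0.
    by rewrite /phi/= ramp_ge ?ramp_le ?subr0//; rewrite /a /b; lra.
  - have e0n := e0 n; have e4n := e4 n; rewrite /phi/=.
    case/orP: xst => ?; first by rewrite !ramp_le ?subrr// /a /b; lra.
    by rewrite !ramp_ge ?subrr// /a /b; lra.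
have E : h s - h t = - \int[lambda]_(x in `]s, t[) k x.
  exact: cvg_unique cvgL (cvgN cvgR).
by rewrite -[RHS]opprK -E opprB.
Unshelve. all: by end_near. Qed.
End du_bois_reymond.

(** * The space L^2 of vector fields *)

Section L2.
Context {R : realType} {d : nat}.
Local Notation mu := (@lebesgue_rV R d).
Local Notation scalar := ('rV[R]_d -> R).
Local Notation vector := ('rV[R]_d -> 'rV[R]_d).
Context (A : set 'rV[R]_d) (mA : measurable A).
Implicit Types (f g : scalar) (u v w : vector) (r : R).

Lemma is_L2_mul f g : is_L2 A f -> is_L2 A g ->
  mu.-integrable A (EFin \o (f \* g)).
Proof.
move=> [mf intf] [mg intg].
have ifg := integrableD mA intf intg.
apply: le_integrable ifg => //.
  by apply/measurable_EFinP; exact: measurable_funM.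
move=> x _; rewrite /= lee_fin normrM [leRHS]ger0_norm ?addr_ge0 ?sqr_ge0//.
have := sqr_ge0 (`|f x| - `|g x|); have := sqr_ge0 (`|f x| + `|g x|).
by rewrite -(real_normK (num_real (f x))) -(real_normK (num_real (g x))); nra.
Qed.

Lemma is_L2D f g : is_L2 A f -> is_L2 A g -> is_L2 A (f + g).
Proof.
move=> Lf Lg; have ifg := is_L2_mul Lf Lg.
have [mf intf] := Lf; have [mg intg] := Lg.
split; first exact: measurable_funD.
have := integrableD mA (integrableD mA intf intg) (integrableZl mA 2 ifg).
apply: eq_integrable => // x _.
by rewrite /= fctE; congr EFin; ring.
Qed.

Lemma is_L2Z r f : is_L2 A f -> is_L2 A (r *: f).
Proof.
move=> [mf intf]; split; first exact: measurable_funM.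
have := integrableZl mA (r ^+ 2) intf.
apply: eq_integrable => // x _.
by rewrite [RHS](_ : _ = (r ^+ 2)%:E * (f x ^+ 2)%:E)%E// -EFinM -exprMn.
Qed.

Lemma is_L2_0 : is_L2 A 0.
Proof.
split; first exact: measurable_cst.
by apply: eq_integrable (integrable0 _ _) => // x _; rewrite /= expr0n.
Qed.

Lemma is_L2vD u v : is_L2v A u -> is_L2v A v -> is_L2v A (u + v).
Proof.
move=> Lu Lv i; rewrite (_ : vcomp _ i = vcomp u i + vcomp v i).
  exact: is_L2D.
by apply/funext => x; rewrite /vcomp fctE mxE.
Qed.

Lemma is_L2vZ r u : is_L2v A u -> is_L2v A (r *: u).
Proof.
move=> Lu i; rewrite (_ : vcomp _ i = r *: vcomp u i); first exact: is_L2Z.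
by apply/funext => x; rewrite /vcomp fctE mxE.
Qed.

Lemma is_L2vB u v : is_L2v A u -> is_L2v A v -> is_L2v A (u - v).
Proof. by move=> Lu Lv; rewrite -scaleN1r; apply: is_L2vD => //; exact: is_L2vZ. Qed.

Lemma is_L2v0 : is_L2v A 0.
Proof.
move=> i; rewrite (_ : vcomp _ i = 0); first exact: is_L2_0.
by apply/funext => x; rewrite /vcomp mxE.
Qed.

Lemma mxdotE (x y : 'rV[R]_d) : mxdot x y = \sum_j x 0 j * y 0 j.
Proof. by rewrite /mxdot big_ord1. Qed.

Lemma mxdotC m n (x y : 'M[R]_(m, n)) : mxdot x y = mxdot y x.
Proof. by apply: eq_bigr => i _; apply: eq_bigr => j _; rewrite mulrC. Qed.

Lemma mxdotDl m n (x y z : 'M[R]_(m, n)) : mxdot (x + y) z = mxdot x z + mxdot y z.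
Proof.
rewrite /mxdot -big_split; apply: eq_bigr => i _ /=.
by rewrite -big_split; apply: eq_bigr => j _; rewrite mxE mulrDl.
Qed.

Lemma mxdotZl m n r (x y : 'M[R]_(m, n)) : mxdot (r *: x) y = r * mxdot x y.
Proof.
rewrite /mxdot mulr_sumr; apply: eq_bigr => i _ /=.
by rewrite mulr_sumr; apply: eq_bigr => j _; rewrite mxE mulrA.
Qed.

Lemma mxdot_ge0 m n (x : 'M[R]_(m, n)) : 0 <= mxdot x x.
Proof.
by apply: sumr_ge0 => i _; apply: sumr_ge0 => j _; rewrite -expr2 sqr_ge0.
Qed.

Lemma integrable_mxdot u v : is_L2v A u -> is_L2v A v ->
  mu.-integrable A (EFin \o (fun x => mxdot (u x) (v x))).
Proof.
move=> Lu Lv.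
rewrite (_ : EFin \o _ = (fun x => \sum_(j < d) (vcomp u j x * vcomp v j x)%:E)%E).
  by apply: integrable_sum => // i _; exact: is_L2_mul.
by apply/funext => x; rewrite /= mxdotE sumEFin.
Qed.

Lemma L2dotvC u v : L2dotv A u v = L2dotv A v u.
Proof. by rewrite /L2dotv; under eq_Rintegral do rewrite mxdotC. Qed.

Lemma L2dotvDl u v w : is_L2v A u -> is_L2v A v -> is_L2v A w ->
  L2dotv A (u + v) w = L2dotv A u w + L2dotv A v w.
Proof.
move=> Lu Lv Lw; rewrite -RintegralD//; [|exact: integrable_mxdot..].
by apply: eq_Rintegral => x _; rewrite fctE mxdotDl.
Qed.

Lemma L2dotvZl r u v : is_L2v A u -> is_L2v A v ->
  L2dotv A (r *: u) v = r * L2dotv A u v.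
Proof.
move=> Lu Lv; rewrite -RintegralZl//; last exact: integrable_mxdot.
by apply: eq_Rintegral => x _; rewrite fctE mxdotZl.
Qed.

Lemma L2dotvBl u v w : is_L2v A u -> is_L2v A v -> is_L2v A w ->
  L2dotv A (u - v) w = L2dotv A u w - L2dotv A v w.
Proof.
move=> Lu Lv Lw; rewrite -scaleN1r L2dotvDl//; last exact: is_L2vZ.
by rewrite L2dotvZl// mulN1r.
Qed.

Lemma L2dotvDr u v w : is_L2v A u -> is_L2v A v -> is_L2v A w ->
  L2dotv A w (u + v) = L2dotv A w u + L2dotv A w v.
Proof. by move=> Lu Lv Lw; rewrite L2dotvC L2dotvDl// !(L2dotvC w). Qed.

Lemma L2dotvZr r u v : is_L2v A u -> is_L2v A v ->
  L2dotv A v (r *: u) = r * L2dotv A v u.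
Proof. by move=> Lu Lv; rewrite L2dotvC L2dotvZl// (L2dotvC v). Qed.

Lemma L2dotv_ge0 u : 0 <= L2dotv A u u.
Proof. by apply: Rintegral_ge0 => x _; exact: mxdot_ge0. Qed.

Lemma L2normv_ge0 u : 0 <= L2normv A u.
Proof. exact: sqrtr_ge0. Qed.

Lemma sqr_L2normv u : L2normv A u ^+ 2 = L2dotv A u u.
Proof. by rewrite sqr_sqrtr// L2dotv_ge0. Qed.

Lemma L2dotv_quad r u v : is_L2v A u -> is_L2v A v ->
  L2dotv A (r *: u + v) (r *: u + v) =
  r ^+ 2 * L2dotv A u u + 2 * r * L2dotv A u v + L2dotv A v v.
Proof.
move=> Lu Lv; have Lru := is_L2vZ r Lu; have LD := is_L2vD Lru Lv.
rewrite L2dotvDl// !L2dotvDr// !L2dotvZl// !L2dotvZr// (L2dotvC v u); ring.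
Qed.

(** The quadratic r -> |r u + v|^2 is nonnegative. Fields are not identified almost everywhere, so
    the form is only semidefinite and |u| = 0 is a separate case. *)
Lemma L2dotv_le u v : is_L2v A u -> is_L2v A v ->
  L2dotv A u v <= L2normv A u * L2normv A v.
Proof.
move=> Lu Lv.
have H r : 0 <= r ^+ 2 * L2dotv A u u + 2 * r * L2dotv A u v + L2dotv A v v.
  by rewrite -L2dotv_quad// L2dotv_ge0.
have : L2dotv A u v ^+ 2 <= L2dotv A u u * L2dotv A v v.
  have := L2dotv_ge0 u; rewrite le_eqVlt => /predU1P[u0|u0].
    rewrite -u0 mul0r; have [->|uv0] := eqVneq (L2dotv A u v) 0; first by rewrite expr0n.
    (* For |u| = 0 the quadratic is affine in [r]; this [r] gives it the value -1, so (u, v) cannot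
       be nonzero. *)
    have := H (- (L2dotv A v v + 1) / L2dotv A u v / 2); rewrite -u0 mulr0 add0r.
    rewrite [X in X + _](_ : _ = - (L2dotv A v v + 1)); last by field.
    by lra.
  have := H (- (L2dotv A u v / L2dotv A u u)).
  rewrite [X in 0 <= X](_ : _ =
    (L2dotv A u u * L2dotv A v v - L2dotv A u v ^+ 2) / L2dotv A u u); last first.
    by field; rewrite gt_eqF.
  by rewrite pmulr_lge0 ?invr_gt0// subr_ge0.
rewrite -sqrtrM ?L2dotv_ge0// => /(@ler_wsqrtr R); rewrite sqrtr_sqr.
exact/le_trans/ler_norm.
Qed.

Lemma ler_L2normvD u v : is_L2v A u -> is_L2v A v ->
  L2normv A (u + v) <= L2normv A u + L2normv A v.
Proof.
move=> Lu Lv; rewrite -(@ler_pXn2r _ 2)// ?nnegrE ?addr_ge0 ?L2normv_ge0//.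
rewrite sqrrD !sqr_L2normv -[u in leLHS]scale1r L2dotv_quad// expr1n mul1r mulr1.
by have := L2dotv_le Lu Lv; lra.
Qed.

Lemma L2normvZ r u : is_L2v A u -> L2normv A (r *: u) = `|r| * L2normv A u.
Proof.
move=> Lu; rewrite /L2normv L2dotvZl ?L2dotvZr//; last exact: is_L2vZ.
by rewrite mulrA -expr2 sqrtrM ?sqr_ge0// sqrtr_sqr.
Qed.

Lemma L2normvBC u v : is_L2v A u -> is_L2v A v ->
  L2normv A (u - v) = L2normv A (v - u).
Proof.
move=> Lu Lv; rewrite -opprB -scaleN1r L2normvZ ?normrN1 ?mul1r//.
exact: is_L2vB.
Qed.

Lemma ler_L2normvB u v w : is_L2v A u -> is_L2v A v -> is_L2v A w ->
  L2normv A (u - w) <= L2normv A (u - v) + L2normv A (v - w).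
Proof.
move=> Lu Lv Lw; rewrite -[u in leLHS](subrK v) -addrA.
by apply: ler_L2normvD; exact: is_L2vB.
Qed.

Lemma ler_L2normv_H1normv u : L2normv A u <= H1normv A u.
Proof.
rewrite ler_wsqrtr// lerDl; apply: Rintegral_ge0 => x _; exact: mxdot_ge0.
Qed.

End L2.

(** * Time derivatives with values in L^2 *)

Section almost_everywhere.
Context {dd : measure_display} {S : measurableType dd} {R : realType}.
Context (m : {measure set S -> \bar R}).

Lemma ae_imp (P Q : S -> Prop) : (forall t, P t -> Q t) ->
  {ae m, forall t, P t} -> {ae m, forall t, Q t}.
Proof.
exact: (@filterS _ _ (ae_filter_ringOfSetsType m)).
Qed.

Lemma ae_and (P Q : S -> Prop) : {ae m, forall t, P t} -> {ae m, forall t, Q t} ->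
  {ae m, forall t, P t /\ Q t}.
Proof.
by apply: (@filterS2 _ _ (ae_filter_ringOfSetsType m)) => t; split.
Qed.

Lemma ae_forall_countable {J : Type} (D : set J) (P : J -> S -> Prop) :
  countable D -> (forall y, D y -> {ae m, forall t, P y t}) ->
  {ae m, forall t, forall y, D y -> P y t}.
Proof.
move=> /countable_injP[f finj] aeP.
have H n : {ae m, forall t, forall y, D y -> f y = n -> P y t}.
  have [[y [Dy fy]]|no] := pselect (exists y, D y /\ f y = n); last first.
    by apply: aeW => t y Dy fy; exfalso; apply: no; exists y.
  apply: (ae_imp _ (aeP _ Dy)) => t Pyt z Dz fz.
  by rewrite (finj z y) ?inE// fz fy.
by apply: (ae_imp _ (ae_foralln H)) => t Ht y Dy; exact: (Ht (f y)).
Qed.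

End almost_everywhere.

Section bochner_L2v.
Context {R : realType} {d : nat}.
Local Notation lambda := (@lebesgue_measure R).
Local Notation vector := ('rV[R]_d -> 'rV[R]_d).
Context (A : set 'rV[R]_d) (mA : measurable A) (T : R).
Local Notation L2 := (is_L2v A).
Local Notation nrm := (L2normv A).
Local Notation dot := (L2dotv A).
Local Notation I := (`]0, T[%classic : set (measurableTypeR R)).

Lemma integrable_cst_itv (a b c : R) : lambda.-integrable `]a, b[ (EFin \o cst c).
Proof.
have mab : measurable (`]a, b[%classic : set (measurableTypeR R)) by [].
apply: measurable_bounded_integrable => //.
  by rewrite /= lebesgue_measure_itv; case: ifP; rewrite ltry.
by exists `|c|; split => // M cM x _; exact: ltW.
Qed.

Lemma ler_dist_L2normv (v w : vector) : L2 v -> L2 w ->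
  `|nrm v - nrm w| <= nrm (v - w).
Proof.
move=> Lv Lw; have LB := is_L2vB mA Lv Lw.
have := ler_L2normvD mA LB Lw; rewrite subrK.
have := ler_L2normvD mA (is_L2vB mA Lw Lv) Lv; rewrite subrK.
by rewrite (L2normvBC mA Lw Lv) ler_norml => ? ?; apply/andP; lra.
Qed.

Lemma normr_L2dotv_le (v w : vector) : L2 v -> L2 w -> `|dot v w| <= nrm v * nrm w.
Proof.
move=> Lv Lw; rewrite ler_norml L2dotv_le// andbT lerNl -mulN1r -L2dotvZl//.
have LN := is_L2vZ mA (-1) Lv.
by apply: le_trans (L2dotv_le mA LN Lw) _; rewrite L2normvZ// normrN1 mul1r.
Qed.

(** A finite range turns every preimage into a finite union of level sets, so [F] is arbitrary and
    no sigma-algebra on the space of fields enters. *)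
Lemma simple_fun_measurable X (s : measurableTypeR R -> vector) (F : vector -> R) :
  simple_fun X s -> measurable_fun setT (F \o s).
Proof.
move=> [fs ms _] _ Y mY; rewrite setTI.
have -> : (F \o s) @^-1` Y = \bigcup_(y in range s `&` F @^-1` Y) s @^-1` [set y].
  apply/seteqP; split=> [x /= Yx|x [y [_ Yy] sxy]]; last by move: Yy; rewrite -sxy.
  by exists (s x) => //; split=> //; exists x.
apply: fin_bigcup_measurable => [|y _]; last exact: ms.
exact: finite_setIl.
Qed.

Lemma bochner_measurable (g : R -> vector) (F : vector -> R) (C : R) :
  (forall t, t \in `]0, T[ -> L2 (g t)) ->
  (exists s : nat -> measurableTypeR R -> vector,
    (forall n, simple_fun L2 (s n)) /\
    forall t, t \in `]0, T[ -> nrm (g t - s n t) @[n --> \oo] --> (0 : R)) ->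
  (forall v w, L2 v -> L2 w -> `|F v - F w| <= C * nrm (v - w)) ->
  measurable_fun I (F \o g).
Proof.
move=> gX [s [ss sg]] FC.
apply: (@measurable_fun_cvg _ _ _ _ (fun n => F \o s n)).
  by move=> n; apply: measurable_funTS; exact: simple_fun_measurable (ss n).
move=> t tT /=; apply/cvgrPdist_le => e e0.
(* No sign is assumed on [C]; the added 1 keeps the divisor positive. *)
have C1 : 0 < `|C| + 1 by rewrite ltr_wpDl.
have /cvgr0Pnorm_le/(_ (e / (`|C| + 1))) := sg t tT.
rewrite divr_gt0// => /(_ isT); apply: filterS => n.
rewrite ger0_norm ?L2normv_ge0// ler_pdivlMr// => H.
have [_ _ sX] := ss n.
apply: le_trans (FC _ _ (gX _ tT) (sX t)) _; apply: le_trans H.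
rewrite mulrC ler_wpM2l ?L2normv_ge0//.
by rewrite (le_trans (ler_norm _))// lerDl.
Qed.

Section strongly_measurable.
Context (g : R -> vector).
Hypothesis gL : bochner_L2 T nrm L2 g.

Let gX t : t \in `]0, T[ -> L2 (g t). Proof. by case: gL => + _ _; exact. Qed.

Let gS : exists s : nat -> measurableTypeR R -> vector,
  (forall n, simple_fun L2 (s n)) /\
  forall t, t \in `]0, T[ -> nrm (g t - s n t) @[n --> \oo] --> (0 : R).
Proof. by case: gL. Qed.

Lemma integrable_nrm (y : vector) : L2 y ->
  lambda.-integrable I (EFin \o (fun t => nrm (g t - y))).
Proof.
move=> Ly; have [_ _ ig2] := gL.
have mI : measurable I by [].
(* The majorant is |g|^2 + 1 + |y|, since |g| <= |g|^2 + 1; the constant part is integrable because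
   the interval is bounded. *)
have := integrableD mI ig2 (integrable_cst_itv 0 T (1 + nrm y)).
apply: le_integrable => //.
  apply/measurable_EFinP.
  apply: (@bochner_measurable g (fun v => nrm (v - y)) 1) => // v w Lv Lw.
  rewrite mul1r.
  have := ler_dist_L2normv (is_L2vB mA Lv Ly) (is_L2vB mA Lw Ly).
  by rewrite opprB addrA subrK.
move=> t tT; rewrite /= lee_fin ger0_norm ?L2normv_ge0//.
have yN := L2normv_ge0 A y; have gN := L2normv_ge0 A (g t).
rewrite ger0_norm; last by rewrite !addr_ge0// sqr_ge0.
have Lgt : L2 (g t) by exact: gX.
have := ler_L2normvD mA Lgt (is_L2vZ mA (-1) Ly).
rewrite L2normvZ// normrN1 mul1r scaleN1r => H; apply: le_trans H _.
nra.
Qed.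

Lemma integrable_dot (w : vector) : L2 w ->
  lambda.-integrable I (EFin \o (fun t => dot (g t) w)).
Proof.
move=> Lw; have L0 := is_L2v0 mA.
have mI : measurable I by [].
have := integrableZl mI (nrm w) (integrable_nrm L0).
apply: le_integrable => //.
  apply/measurable_EFinP.
  apply: (@bochner_measurable g (fun v => dot v w) (nrm w)) => // v1 v2 Lv1 Lv2.
  rewrite -L2dotvBl// mulrC; apply: normr_L2dotv_le => //; exact: is_L2vB.
move=> t tT; rewrite /= lee_fin subr0 normrM !(ger0_norm (L2normv_ge0 _ _)).
by rewrite mulrC; apply: normr_L2dotv_le => //; exact: gX.
Qed.

End strongly_measurable.

(** Extending [f] by zero outside []0, T[] makes the integrand integrable on the whole line, so that
    the primitive makes sense at every [x] and Lebesgue differentiation applies to it. *)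
Definition primitive (f : R -> R) (x : R) : R :=
  \int[lambda]_(t in `[0, x]) (f \_ I) t.

Lemma primitiveB (f : R -> R) s t : lambda.-integrable I (EFin \o f) ->
  0 <= s -> s <= t -> t <= T ->
  primitive f t - primitive f s = \int[lambda]_(x in `]s, t[) f x.
Proof.
move=> iF s0 st tT.
have mI : measurable I by [].
have iFT : lambda.-integrable setT (EFin \o (f \_ I)).
  by rewrite -restrict_EFin; exact/(integrable_mkcond _ mI).
have iFS (i : interval R) : lambda.-integrable [set` i] (EFin \o (f \_ I)).
  exact: integrableS iFT.
rewrite /primitive Rintegral_itvB ?bnd_simp//.
rewrite -Rintegral_itv_bndo_bndc//; apply: eq_Rintegral => x.
rewrite inE /= in_itv/= => /andP[? ?]; rewrite patchE ifT// inE /= in_itv/=.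
by apply/andP; lra.
Qed.

Lemma ae_derivable_primitive (f : R -> R) : lambda.-integrable I (EFin \o f) ->
  {ae lambda, forall t, t \in `]0, T[ ->
    h^-1 * (primitive f (h + t) - primitive f t) @[h --> 0^'] --> f t}.
Proof.
move=> iF; have mI : measurable I by [].
have iFT : lambda.-integrable setT (EFin \o (f \_ I)).
  by rewrite -restrict_EFin; exact/(integrable_mkcond _ mI).
have iFS y : lambda.-integrable [set` Interval (BLeft 0) (BRight y)]
    (EFin \o (f \_ I)).
  exact: integrableS iFT.
apply: ae_imp (FTC1 iFS (integrable_locally mI iF)) => t Ht tT.
have [|dF F't] := Ht.
  by rewrite /= lte_fin; move: tT; rewrite in_itv => /andP[].
have : h^-1 *: (primitive f (h *: (1 : R) + t) - primitive f t) @[h --> 0^'] -->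
    'D_1 (primitive f) t by exact: dF.
rewrite -derive1E F't patchE ifT; last exact/mem_set.
apply: cvg_trans; apply: near_eq_cvg; apply: nearW => h.
by rewrite /GRing.scale/= mulr1.
Qed.

(** The H^1 norm dominates the L^2 norm, so the coarse scales can be treated by the same L^2 theory
    as the fine ones. *)
Lemma in_VhT_in_VfT (X : set vector) (u g : R -> vector) : X `<=` L2 ->
  in_VhT A T X u g -> in_VfT A T u g.
Proof.
move=> XL [uC [gX [s [ss sg]] ig] uw].
have sX n t : X (s n t) by have [_ _] := ss n; exact.
have sqz (F : set_system R) (FF : Filter F) (v : R -> vector) :
    H1normv A (v x) @[x --> F] --> (0 : R) -> nrm (v x) @[x --> F] --> (0 : R).
  move=> H; apply: (squeeze_cvgr _ (cvg_cst 0) H); apply: nearW => x.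
  by rewrite L2normv_ge0 ler_L2normv_H1normv.
have gS : exists s : nat -> measurableTypeR R -> vector,
    (forall n, simple_fun L2 (s n)) /\
    forall t, t \in `]0, T[ -> nrm (g t - s n t) @[n --> \oo] --> (0 : R).
  exists s; split=> [n|t tT].
    by have [? ? ?] := ss n; split => // t; exact: XL.
  apply: (squeeze_cvgr _ (cvg_cst 0) (sg t tT)); apply: nearW => n.
  by rewrite L2normv_ge0 ler_L2normv_H1normv.
have gL t : t \in `]0, T[ -> L2 (g t) by move=> tT; exact/XL/gX.
split=> //.
- by move=> t tT; have [Xut ut] := uC t tT; split; [exact: XL|exact: sqz].
(* Domination by the H^1 norm bounds the integral but says nothing about measurability of the L^2
   norm of [g], which comes from the approximating simple functions. *)
- split=> //; apply: le_integrable ig => //.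
    apply/measurable_EFinP; apply: measurable_funX.
    apply: (@bochner_measurable g nrm 1) => // v w Lv Lw.
    by rewrite mul1r ler_dist_L2normv.
  move=> t tT; rewrite lee_fin !ger0_norm ?sqr_ge0//.
  by rewrite lerXn2r ?nnegrE ?sqrtr_ge0// ler_L2normv_H1normv.
Qed.

Section time_derivative.
Context (u g : R -> vector).
Hypothesis ug : in_VfT A T u g.

Let uL t : 0 <= t <= T -> L2 (u t).
Proof. by move=> tT; have [+ _ _] := ug => /(_ t); rewrite in_itv => /(_ tT)[]. Qed.

Let gL : bochner_L2 T nrm L2 g. Proof. by case: ug. Qed.

Let gX t : t \in `]0, T[ -> L2 (g t). Proof. by case: gL => + _ _; exact. Qed.

Lemma L2dotv_increment (w : vector) s t : L2 w -> 0 <= s -> s <= t -> t <= T ->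
  dot (u t - u s) w = \int[lambda]_(x in `]s, t[) dot (g x) w.
Proof.
move=> Lw s0 st tT; have [uC _ uw] := ug.
rewrite L2dotvBl//; [|by apply: uL; lra..].
apply: (@du_bois_reymond _ T (fun x => dot (u x) w) (fun x => dot (g x) w)) => //.
- apply/subspace_continuousP => x; rewrite /= in_itv/= => xT.
  have [Lux ux] := uC _ xT.
  have w0 := L2normv_ge0 A w.
  apply/cvgrPdist_le => e e0.
  have /cvgr0Pnorm_le/(_ (e / (nrm w + 1))) := ux.
  rewrite divr_gt0 ?ltr_wpDl// => /(_ isT).
  rewrite !near_withinE; apply: filterS => z H zT; have {}H := H zT.
  have [Luz _] := uC _ zT.
  change (`|dot (u x) w - dot (u z) w| <= e).
  rewrite -L2dotvBl//; apply: le_trans (normr_L2dotv_le (is_L2vB mA Lux Luz) Lw) _.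
  move: H; rewrite L2normvBC// ger0_norm ?L2normv_ge0// ler_pdivlMr ?ltr_wpDl//.
  by apply: le_trans; rewrite ler_wpM2l ?L2normv_ge0// lerDl.
- exact: integrable_dot.
- by move=> phi tphi; exact: uw.
Qed.

(** Duality: testing with the left-hand vector [D] itself gives |D|^2 as the integral of (g - y, D),
    at most |D| times the right-hand side. With [y = 0] this controls increments of [u]; general [y]
    serves the strong differentiation. *)
Lemma L2normv_increment_le (y : vector) s t : L2 y -> 0 <= s -> s <= t -> t <= T ->
  nrm (u t - u s - (t - s) *: y) <= \int[lambda]_(x in `]s, t[) nrm (g x - y).
Proof.
move=> Ly s0 st tT.
set D := _ - _ - _.
have Lus : L2 (u s) by apply: uL; lra.
have Lut : L2 (u t) by apply: uL; lra.
have LB := is_L2vB mA Lut Lus.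
have LD : L2 D by apply: is_L2vB => //; exact: is_L2vZ.
have stT : `]s, t[ `<=` I.
  by move=> x /=; rewrite !in_itv/= => /andP[? ?]; apply/andP; lra.
have ms : measurable (`]s, t[%classic : set (measurableTypeR R)) by [].
have mI : measurable I by [].
have ig := integrableS mI ms stT (integrable_dot gL LD).
have in_ := integrableS mI ms stT (integrable_nrm gL Ly).
have ic : lambda.-integrable `]s, t[ (EFin \o cst (dot y D)).
  exact: integrable_cst_itv.
have H : nrm D ^+ 2 <= nrm D * \int[lambda]_(x in `]s, t[) nrm (g x - y).
  rewrite sqr_L2normv {1}/D L2dotvBl//; last exact: is_L2vZ.
  rewrite L2dotv_increment// L2dotvZl//.
  have -> : (t - s) * dot y D = \int[lambda]_(x in `]s, t[) dot y D.
    rewrite (Rintegral_cst _ ms) /= lebesgue_measure_itv/= lte_fin.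
    case: ltP => //= ts.
      by rewrite mulrC.
    by rewrite mulr0 (_ : t - s = 0) ?mul0r//; lra.
  rewrite -RintegralB// -RintegralZl//; apply: le_Rintegral => //.
  - by have := integrableB ms ig ic; apply: eq_integrable.
  - by have := integrableZl ms (nrm D) in_; apply: eq_integrable.
  - move=> x xst; have xT : x \in `]0, T[ by exact: stT.
    rewrite -L2dotvBl//; last exact: gX.
    rewrite mulrC; apply: L2dotv_le => //; apply: is_L2vB => //; exact: gX.
have := L2normv_ge0 A D; rewrite le_eqVlt => /predU1P[<-|D0].
  by apply: Rintegral_ge0 => x _; exact: L2normv_ge0.
by move: H; rewrite expr2 ler_pM2l.
Qed.

Lemma ae_strong_derivative :
  {ae lambda, forall t, t \in `]0, T[ ->
    nrm (h^-1 *: (u (h + t) - u t) - g t) @[h --> 0^'] --> (0 : R)}.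
Proof.
have [_ [s [ss sg]] _] := gL.
pose D := \bigcup_n range (s n).
have cD : countable D.
  apply: bigcup_countable => // n _; apply: finite_set_countable.
  by have [] := ss n.
have DL y : D y -> L2 y.
  by move=> [n _ [t _ <-]]; have [_ _] := ss n; exact.
apply: ae_imp (ae_forall_countable cD (fun y Dy =>
  ae_derivable_primitive (integrable_nrm gL (DL y Dy)))) => t Ht tT.
have t0T : 0 < t < T by rewrite in_itv in tT.
have Lgt : L2 (g t) by exact: gX.
have Lut : L2 (u t) by apply: uL; lra.
apply/cvgr0Pnorm_le => e e0.
(* The distance |g(t) - y| is paid twice, once as the limit of the averages of |g - y| and once to
   pass from [y] back to [g t]; the last third is the error in that limit. *)
have e3 : 0 < e / 3 by rewrite divr_gt0.
have /cvgr0Pnorm_le/(_ _ e3)[n _ /(_ n (leqnn n))] := sg t tT.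
rewrite ger0_norm ?L2normv_ge0//; set y := s n t => ye.
have Dy : D y by exists n => //; exists t.
have Ly := DL _ Dy.
have /cvgrPdist_le/(_ _ e3) := Ht _ Dy tT.
apply: filter_app; near=> h => Hh.
have h0 : h != 0 by near: h; exact: nbhs_dnbhs_neq.
have hs : `|h| <= Num.min t (T - t).
  by near: h; apply: dnbhs0_le; rewrite lt_min; lra.
have htT : 0 <= h + t <= T.
  by move: hs; rewrite le_min !ler_norml; lra.
have Luh : L2 (u (h + t)) by exact: uL.
have LB := is_L2vB mA Luh Lut.
have LBh := is_L2vZ mA h^-1 LB.
rewrite ger0_norm ?L2normv_ge0//.
apply: le_trans (ler_L2normvB mA LBh Ly Lgt) _.
rewrite (L2normvBC mA Ly Lgt).
suff H : nrm (h^-1 *: (u (h + t) - u t) - y) <=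
    h^-1 * (primitive (fun t => nrm (g t - y)) (h + t) -
            primitive (fun t => nrm (g t - y)) t).
  by have := ye; move: Hh H; rewrite ler_norml; lra.
have -> : h^-1 *: (u (h + t) - u t) - y = h^-1 *: (u (h + t) - u t - h *: y).
  by rewrite [RHS]scalerBr scalerA mulVf// scale1r.
have LBy := is_L2vB mA LB (is_L2vZ mA h Ly).
rewrite L2normvZ// normfV.
have [hn|hp] := ltP h 0.
- rewrite ltr0_norm// invrN -[leRHS]mulrNN opprB ler_pM2l ?oppr_gt0 ?invr_lt0//.
  rewrite primitiveB//; [|exact: integrable_nrm|lra..].
  have := @L2normv_increment_le y (h + t) t Ly.
  have Lhy := is_L2vZ mA h Ly.
  have -> : u t - u (h + t) - (t - (h + t)) *: y = - (u (h + t) - u t - h *: y).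
    by rewrite !opprB opprD addrCA subrr addr0 scaleNr opprK addrC.
  rewrite -scaleN1r L2normvZ// normrN1 mul1r; apply; lra.
- have {}hp : 0 < h by rewrite lt_neqAle eq_sym h0.
  rewrite ger0_norm ?(ltW hp)// ler_pM2l ?invr_gt0//.
  rewrite primitiveB//; [|exact: integrable_nrm|lra..].
  have := @L2normv_increment_le y t (h + t) Ly; rewrite addrK; apply; lra.
Unshelve. all: by end_near. Qed.

End time_derivative.
End bochner_L2v.

(** * Evolution of the energy *)

Section ae_integral.
Context {dd : measure_display} {S : measurableType dd} {R : realType}.
Context (m : {measure set S -> \bar R}).

Lemma ae_le_Rintegral (D : set S) (f1 f2 : S -> R) : measurable D ->
  m.-integrable D (EFin \o f1) -> m.-integrable D (EFin \o f2) ->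
  {ae m, forall x, D x -> f1 x <= f2 x} ->
  \int[m]_(x in D) f1 x <= \int[m]_(x in D) f2 x.
Proof.
move=> mD i1 i2 [N [mN N0 hN]].
rewrite /Rintegral (negligible_integral mN mD i1 N0).
rewrite (negligible_integral mN mD i2 N0).
have mDN : measurable (D `\` N) by exact: measurableD.
apply: le_Rintegral => //; [exact: integrableS i1|exact: integrableS i2|].
move=> x [Dx Nx]; have [//|no] := pselect (f1 x <= f2 x).
by exfalso; apply: Nx; apply: hN => /= /(_ Dx).
Qed.

End ae_integral.

Section energy.
Context {R : realType} {d : nat}.
Local Notation lambda := (@lebesgue_measure R).
Local Notation vector := ('rV[R]_d -> 'rV[R]_d).

(* Bisecting with the intermediate value theorem so that each half carries half
   of the increment of G halves the quadratic bound. *)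
Lemma le_of_quadratic_increment (E G : R -> R) s t : s <= t ->
  {within `[s, t], continuous G} ->
  (forall a b, s <= a -> a <= b -> b <= t -> G a <= G b) ->
  (forall a b, s <= a -> a <= b -> b <= t -> E b - E a <= (G b - G a) ^+ 2) ->
  E t <= E s.
Proof.
move=> st Gc Gnd EG.
have H n a b : s <= a -> a <= b -> b <= t ->
    E b - E a <= (G b - G a) ^+ 2 / 2 ^+ n.
  elim: n a b => [|n IH] a b sa ab bt; first by rewrite expr0 divr1; exact: EG.
  have Gab := Gnd _ _ sa ab bt.
  have [||m mab Gm] := @IVT R G a b ((G a + G b) / 2) ab.
  - apply: continuous_subspaceW Gc => x; rewrite /= !in_itv/=.
    by move=> /andP[? ?]; apply/andP; lra.
  - by rewrite (min_idPl Gab) (max_idPr Gab); lra.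
  have [am mb] : a <= m /\ m <= b by move: mab; rewrite in_itv/= => /andP.
  have := IH _ _ sa am (le_trans mb bt); have := IH _ _ (le_trans sa am) mb bt.
  rewrite Gm.
  have -> : (G b - (G a + G b) / 2) ^+ 2 = (G b - G a) ^+ 2 / 4 by field.
  have -> : ((G a + G b) / 2 - G a) ^+ 2 = (G b - G a) ^+ 2 / 4 by field.
  have -> : (G b - G a) ^+ 2 / 2 ^+ n.+1 = 2 * ((G b - G a) ^+ 2 / 4 / 2 ^+ n).
    have : (2 : R) ^+ n != 0 by rewrite expf_neq0.
    by rewrite (exprS 2 n); set q := 2 ^+ n => q0; field.
  by lra.
rewrite -subr_le0.
have cv : (G t - G s) ^+ 2 / 2 ^+ n @[n --> \oo] --> 0.
  rewrite -(mulr0 ((G t - G s) ^+ 2)); apply: cvgM; first exact: cvg_cst.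
  under eq_fun do rewrite -exprVn.
  by apply: cvg_expr; rewrite ger0_norm ?invr_ge0// invf_lt1// ltr1n.
by apply: (cvgr_to_ge cv); apply: nearW => n; exact: H.
Qed.

Context (A : set 'rV[R]_d) (mA : measurable A) (T : R).
Local Notation L2 := (is_L2v A).
Local Notation nrm := (L2normv A).
Local Notation dot := (L2dotv A).
Local Notation I := (`]0, T[%classic : set (measurableTypeR R)).

Lemma half_sqr_L2normvB v w : L2 v -> L2 w ->
  2^-1 * nrm v ^+ 2 - 2^-1 * nrm w ^+ 2 = 2^-1 * dot (v - w) (v + w).
Proof.
move=> Lv Lw; rewrite !sqr_L2normv L2dotvBl//; last exact: is_L2vD.
by rewrite !L2dotvDr// (L2dotvC _ w v); ring.
Qed.

(** Writing w + v = (w - v) + 2 v separates the first-order term from a remainder that carries a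
    factor [h] and vanishes as soon as the quotient stays bounded. *)
Lemma half_sqr_L2normv_quotient v w h : h != 0 -> L2 v -> L2 w ->
  h^-1 * (2^-1 * nrm w ^+ 2 - 2^-1 * nrm v ^+ 2) =
  dot (h^-1 *: (w - v)) v + h / 2 * nrm (h^-1 *: (w - v)) ^+ 2.
Proof.
move=> h0 Lv Lw; rewrite half_sqr_L2normvB// sqr_L2normv.
have LB := is_L2vB mA Lw Lv.
have -> : w + v = (w - v) + 2 *: v.
  by rewrite scaler_nat mulr2n addrA subrK.
rewrite L2dotvDr//; last exact: is_L2vZ.
rewrite !L2dotvZl//; last exact: is_L2vZ.
rewrite !L2dotvZr//; field => //.
Qed.

Context (u1 g1 u2 g2 : R -> vector).
Hypotheses (ug1 : in_VfT A T u1 g1) (ug2 : in_VfT A T u2 g2).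
(** Coarse and fine scales keep separate derivatives and separate approximating simple functions;
    their estimates are added by the triangle inequality only at the end. *)
Let u t := u1 t + u2 t.
Let g t := g1 t + g2 t.
Let E (t : R) := 2^-1 * nrm (u t) ^+ 2.

Let uX (v h : R -> vector) t : in_VfT A T v h -> 0 <= t <= T -> L2 (v t).
Proof. by move=> [+ _ _] tT => /(_ t); rewrite in_itv => /(_ tT)[]. Qed.

Let gX (v h : R -> vector) t : in_VfT A T v h -> 0 < t < T -> L2 (h t).
Proof. by move=> [_ [+ _ _] _] tT => /(_ t); rewrite in_itv; exact. Qed.

Let uL t : 0 <= t <= T -> L2 (u t).
Proof. by move=> tT; apply: is_L2vD => //; [exact: uX ug1 _|exact: uX ug2 _]. Qed.

Let gL t : 0 < t < T -> L2 (g t).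
Proof. by move=> tT; apply: is_L2vD => //; [exact: gX ug1 _|exact: gX ug2 _]. Qed.

Lemma ae_energy_derivative :
  {ae lambda, forall t, t \in `]0, T[ ->
    derivable E t 1 /\ 'D_1 E t = dot (g t) (u t)}.
Proof.
have H1 := ae_strong_derivative mA ug1.
have H2 := ae_strong_derivative mA ug2.
have := @ae_and _ _ _ lambda _ _ H1 H2 => {H1 H2}.
apply: ae_imp => t [H1 H2] tT; have {}H1 := H1 tT; have {}H2 := H2 tT.
have t0T : 0 < t < T by rewrite in_itv in tT.
have t0T' : 0 <= t <= T by lra.
have Lu := uL t0T'; have Lg := gL t0T.
pose D h := h^-1 *: (u (h + t) - u t).
pose del h := nrm (h^-1 *: (u1 (h + t) - u1 t) - g1 t) +
  nrm (h^-1 *: (u2 (h + t) - u2 t) - g2 t).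
have cdel : del h @[h --> 0^'] --> (0 : R).
  by have := cvgD H1 H2; rewrite addr0; exact.
suff cv : h^-1 *: (E (h *: (1 : R) + t) - E t) @[h --> 0^'] --> dot (g t) (u t).
  by split; [apply/cvg_ex; exists (dot (g t) (u t))|exact/cvg_lim].
have cid : (h : R) @[h --> 0^'] --> (0 : R) by exact: nbhs_dnbhs.
(* This majorizes the error of the energy quotient: the first summand bounds (D h - g t, u t), the
   second the remainder of order [h], where |D h| <= del h + |g t|. *)
have cb : del h * nrm (u t) + `|h| / 2 * (del h + nrm (g t)) ^+ 2
    @[h --> 0^'] --> (0 : R).
  rewrite [X in _ --> X](_ : (0 : R) =
    0 * nrm (u t) + `|0 : R| / 2 * (0 + nrm (g t)) ^+ 2); last first.
    by rewrite normr0 !mul0r addr0.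
  apply: cvgD; first by apply: cvgM => //; exact: cvg_cst.
  apply: cvgM; first by apply: cvgM; [exact: cvg_norm|exact: cvg_cst].
  by apply: (@cvg_comp _ _ _ _ (fun x => x ^+ 2)); last exact: exprn_continuous;
    apply: cvgD => //; exact: cvg_cst.
apply/cvgrPdist_le => e e0.
have /cvgr0Pnorm_le/(_ _ e0) := cb.
apply: filter_app; near=> h => Hh.
have h0 : h != 0 by near: h; exact: nbhs_dnbhs_neq.
have hs : `|h| <= Num.min t (T - t).
  by near: h; apply: dnbhs0_le; rewrite lt_min; lra.
have htT : 0 <= h + t <= T.
  by move: hs; rewrite le_min !ler_norml; lra.
have Luh : L2 (u (h + t)) by exact: uL.
have LB := is_L2vB mA Luh Lu.
have LD : L2 (D h) by exact: is_L2vZ.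
apply: le_trans (le_trans (ler_norm _) Hh).
rewrite /GRing.scale/= mulr1.
have LDg := is_L2vB mA LD Lg.
have Ddel : nrm (D h - g t) <= del h.
  have -> : D h - g t = (h^-1 *: (u1 (h + t) - u1 t) - g1 t) +
      (h^-1 *: (u2 (h + t) - u2 t) - g2 t).
    rewrite /D /u /g [in RHS]addrACA -scalerDr !opprD.
    by congr (_ *: _ + _); rewrite addrACA.
  have L1 := is_L2vZ mA h^-1 (is_L2vB mA (uX ug1 htT) (uX ug1 t0T')).
  have L2' := is_L2vZ mA h^-1 (is_L2vB mA (uX ug2 htT) (uX ug2 t0T')).
  have L3 := is_L2vB mA L1 (gX ug1 t0T); have L4 := is_L2vB mA L2' (gX ug2 t0T).
  exact: ler_L2normvD.
have Dn : nrm (D h) <= del h + nrm (g t).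
  rewrite -[D h](subrK (g t)); apply: le_trans (ler_L2normvD mA LDg Lg) _.
  by rewrite lerD2r.
rewrite half_sqr_L2normv_quotient// -/(D h).
have -> : dot (g t) (u t) - (dot (D h) (u t) + h / 2 * nrm (D h) ^+ 2) =
   - (dot (D h - g t) (u t) + h / 2 * nrm (D h) ^+ 2).
  by rewrite L2dotvBl//; ring.
rewrite normrN (le_trans (ler_normD _ _))// lerD//.
  apply: le_trans (normr_L2dotv_le mA LDg Lu) _.
  by rewrite ler_wpM2r// L2normv_ge0.
rewrite normrM (ger0_norm (sqr_ge0 _)) normrM (ger0_norm (_ : 0 <= 2^-1))//.
rewrite ler_wpM2l ?mulr_ge0// lerXn2r ?nnegrE ?L2normv_ge0//.
by rewrite addr_ge0 ?L2normv_ge0// /del addr_ge0 ?L2normv_ge0.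
Unshelve. all: by end_near. Qed.

Let G (x : R) := nrm (g1 x) + nrm (g2 x).

Let iG : lambda.-integrable I (EFin \o G).
Proof.
have mI : measurable I by [].
have [_ g1L _] := ug1; have [_ g2L _] := ug2.
have L0 := is_L2v0 mA.
have := integrableD mI (integrable_nrm mA g1L L0) (integrable_nrm mA g2L L0).
by apply: eq_integrable => // x _; rewrite /= !subr0.
Qed.

Let sub_itv s t : 0 <= s -> t <= T -> `]s, t[ `<=` I.
Proof.
by move=> s0 tT x /=; rewrite !in_itv/= => /andP[? ?]; apply/andP; lra.
Qed.

Let increment_le s t : 0 <= s -> s <= t -> t <= T ->
  nrm (u t - u s) <= primitive T G t - primitive T G s.
Proof.
move=> s0 st tT; have L0 := is_L2v0 mA.
have sT : 0 <= s <= T by lra.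
have tT' : 0 <= t <= T by lra.
have mI : measurable I by [].
have mst : measurable (`]s, t[%classic : set (measurableTypeR R)) by [].
have [_ g1L _] := ug1; have [_ g2L _] := ug2.
have i1 := integrableS mI mst (sub_itv s0 tT) (integrable_nrm mA g1L L0).
have i2 := integrableS mI mst (sub_itv s0 tT) (integrable_nrm mA g2L L0).
rewrite primitiveB//.
have := L2normv_increment_le mA ug2 L0 s0 st tT.
have := L2normv_increment_le mA ug1 L0 s0 st tT.
rewrite !scaler0 !subr0 => H1 H2.
have -> : \int[lambda]_(x in `]s, t[) G x =
    \int[lambda]_(x in `]s, t[) nrm (g1 x - 0) +
    \int[lambda]_(x in `]s, t[) nrm (g2 x - 0).
  rewrite -(RintegralD mst i1 i2); apply: eq_Rintegral => x _.
  by rewrite /G !subr0.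
have -> : u t - u s = (u1 t - u1 s) + (u2 t - u2 s) by rewrite /u opprD addrACA.
apply: (le_trans _ (lerD H1 H2)).
have L1 := is_L2vB mA (uX ug1 tT') (uX ug1 sT).
have L2' := is_L2vB mA (uX ug2 tT') (uX ug2 sT).
exact: ler_L2normvD.
Qed.

(** The midpoint [w] of [u a] and [u b] does not depend on time, so the weak derivative can be
    tested with it and gives the energy increment exactly. In w = u x + (w - u x) the first part
    contributes a nonpositive term, and the second is at most the increment of the primitive of [G],
    whence the quadratic bound. *)
Lemma energy_nonincreasing :
  {ae lambda, forall t, t \in `]0, T[ -> dot (g t) (u t) <= 0} ->
  forall s t, 0 <= s -> s <= t -> t <= T -> E t <= E s.
Proof.
have midpoint_le (x y pa px pb : R) : x <= pb - px -> y <= px - pa ->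
    pa <= px -> px <= pb -> 2^-1 * x + 2^-1 * y <= pb - pa by lra.
move=> gu_le0 s t s0 st tT.
have mI : measurable I by [].
have Gge0 x : 0 <= G x by rewrite addr_ge0 ?L2normv_ge0.
have Gnd a b : 0 <= a -> a <= b -> b <= T -> primitive T G a <= primitive T G b.
  move=> a0 ab bT; rewrite -subr_ge0 primitiveB//.
  by apply: Rintegral_ge0 => x _.
apply: (le_of_quadratic_increment (G := primitive T G) st)
  => [|a b sa ab bt|a b sa ab bt].
- have T0 : 0 <= T by lra.
  apply: (@continuous_subspaceW _ _ _ `[0, T]).
    by move=> x /=; rewrite !in_itv/= => /andP[? ?]; apply/andP; lra.
  apply: parameterized_integral_continuous => //.
  have : lambda.-integrable setT (EFin \o (G \_ I)).
    by rewrite -restrict_EFin; exact/(integrable_mkcond _ mI).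
  exact: integrableS.
- apply: Gnd; lra.
have a0 : 0 <= a by lra.
have bT : b <= T by lra.
have aT : 0 <= a <= T by lra.
have bT' : 0 <= b <= T by lra.
have mab : measurable (`]a, b[%classic : set (measurableTypeR R)) by [].
have Lua : L2 (u a) by apply: uL; lra.
have Lub : L2 (u b) by apply: uL; lra.
set w := 2^-1 *: (u b + u a).
have Lw : L2 w by apply: is_L2vZ => //; exact: is_L2vD.
have [_ g1L _] := ug1; have [_ g2L _] := ug2.
have i1 := integrableS mI mab (sub_itv a0 bT) (integrable_dot mA g1L Lw).
have i2 := integrableS mI mab (sub_itv a0 bT) (integrable_dot mA g2L Lw).
have iGab := integrableS mI mab (sub_itv a0 bT) iG.
pose del := primitive T G b - primitive T G a.
have -> : E b - E a = \int[lambda]_(x in `]a, b[) (dot (g1 x) w + dot (g2 x) w).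
  rewrite /E half_sqr_L2normvB// RintegralD//.
  rewrite -(L2dotv_increment mA ug1)// -(L2dotv_increment mA ug2)//.
  rewrite -L2dotvZr//; [|exact: is_L2vD|exact: is_L2vB].
  have L1 := is_L2vB mA (uX ug1 bT') (uX ug1 aT).
  have L2' := is_L2vB mA (uX ug2 bT') (uX ug2 aT).
  rewrite -L2dotvDl//.
  by congr (dot _ _); rewrite /u opprD addrACA.
rewrite -/del expr2 {1}/del primitiveB// -RintegralZr//.
apply: ae_le_Rintegral => //.
- by have := integrableD mab i1 i2; apply: eq_integrable.
- have := integrableZl mab del iGab; apply: eq_integrable => // x _.
  by rewrite /= mulrC.
apply: ae_imp gu_le0 => x gux xab.
have xT : 0 < x < T by have := sub_itv a0 bT xab; rewrite /= in_itv.
have [ax xb] : a <= x /\ x <= b.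
  by move: xab; rewrite /= in_itv/= => /andP[? ?]; split; exact: ltW.
have Lg1 := gX ug1 xT; have Lg2 := gX ug2 xT; have Lg := gL xT.
have Lux : L2 (u x) by apply: uL; case/andP: xT => ? ?; rewrite !ltW.
rewrite -L2dotvDl// -/(g x).
have -> : w = u x + (w - u x) by rewrite addrC subrK.
have LB := is_L2vB mA Lw Lux.
rewrite L2dotvDr//.
have H1 : dot (g x) (u x) <= 0 by apply: gux; rewrite in_itv.
have H2 := L2dotv_le mA Lg LB.
have H3 : nrm (g x) <= G x by exact: ler_L2normvD.
(* Since [w] is the midpoint, half the increment of the primitive over [x, b] and half of that over
   [a, x] add up to [del / 2], which is at most [del]. *)
have H4 : nrm (w - u x) <= del.
  have LBb := is_L2vB mA Lub Lux; have LBa := is_L2vB mA Lua Lux.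
  have -> : w - u x = 2^-1 *: (u b - u x) + 2^-1 *: (u a - u x).
    rewrite -scalerDr addrACA -opprD scalerBr -[u x in X in _ = _ - X]scale1r.
    by rewrite -scalerDl scalerA (_ : 2^-1 * (1 + 1) = 1) ?scale1r//; field.
  apply: le_trans (ler_L2normvD mA (is_L2vZ mA _ LBb) (is_L2vZ mA _ LBa)) _.
  rewrite !L2normvZ// ger0_norm// (L2normvBC mA Lua Lux).
  have Ha := increment_le a0 ax (le_trans xb bT).
  have Hb := increment_le (le_trans a0 ax) xb bT.
  have Gax := Gnd _ _ a0 ax (le_trans xb bT).
  have Gxb := Gnd _ _ (le_trans a0 ax) xb bT.
  exact: midpoint_le _ _ _ _ _ Hb Ha Gax Gxb.
have H5 : nrm (g x) * nrm (w - u x) <= G x * del.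
  by apply: ler_pM H3 H4; exact: sqrtr_ge0.
by apply: le_trans (lerD H1 (le_trans H2 H5)) _; rewrite add0r.
Qed.

End energy.

(** * The equations at a fixed time *)

Section L2_more.
Context {R : realType} {d : nat}.
Local Notation mu := (@lebesgue_rV R d).
Local Notation scalar := ('rV[R]_d -> R).
Local Notation vector := ('rV[R]_d -> 'rV[R]_d).
Implicit Types (A B : set 'rV[R]_d) (f g : scalar) (u v : vector).

Lemma is_L2S A B f : measurable A -> measurable B -> B `<=` A ->
  is_L2 A f -> is_L2 B f.
Proof.
move=> mA mB BA [mf intf]; split; first exact: measurable_funS mf.
exact: integrableS intf.
Qed.

Lemma is_L2vS A B u : measurable A -> measurable B -> B `<=` A ->
  is_L2v A u -> is_L2v B u.
Proof. by move=> mA mB BA Lu i; exact: is_L2S (Lu i). Qed.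

(* wderiv is zero when there is no weak derivative in L^2. *)
Lemma is_L2_wderiv A j f : measurable A -> is_L2 A (wderiv A j f).
Proof.
move=> mA; rewrite /wderiv; case: xgetP => [g _ []//|_].
exact: is_L2_0.
Qed.

Lemma is_L2_sum A n (F : 'I_n -> scalar) : measurable A ->
  (forall i, is_L2 A (F i)) -> is_L2 A (\sum_i F i).
Proof.
move=> mA LF; apply: (big_ind (is_L2 A)) => //; first exact: is_L2_0.
by move=> f g; exact: is_L2D.
Qed.

Lemma is_L2_bounded_mul A f g (M : R) : measurable A -> measurable_fun A f ->
  {ae mu, forall x, A x -> `|f x| <= M} -> is_L2 A g -> is_L2 A (f \* g).
Proof.
move=> mA mf fM [mg ig].
have mfg : measurable_fun A (f \* g) by exact: measurable_funM.
split => //; apply/integrableP.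
have mfg2 : measurable_fun A (fun x => ((f \* g) x ^+ 2)%:E).
  by apply/measurable_EFinP; exact: measurable_funX.
split=> //.
have := integrableZl mA (M ^+ 2) ig => /integrableP[mMg]; apply: le_lt_trans.
apply: ae_ge0_le_integral => //.
- exact: measurableT_comp.
- exact: measurableT_comp.
apply: ae_imp fM => x fxM Ax; have fM := fxM Ax.
have M0 : 0 <= M by exact: le_trans fM.
rewrite lee_fin (ger0_norm (sqr_ge0 _)).
rewrite (ger0_norm (mulr_ge0 (sqr_ge0 _) (sqr_ge0 _))).
rewrite exprMn ler_wpM2r ?sqr_ge0// -(real_normK (num_real (f x))).
by rewrite lerXn2r ?nnegrE.
Qed.

(* The bound on a makes the convective term square-integrable; for elements of
   Vh it comes from the piecewise rational structure. *)
Lemma is_L2v_advect A (a v : vector) (M : R) : measurable A -> is_L2v A a ->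
  {ae mu, forall x, A x -> forall i, `|a x 0 i| <= M} ->
  is_L2v A (advect A a v).
Proof.
move=> mA La aM i.
rewrite (_ : vcomp _ i = \sum_j (vcomp a j \* wderiv A j (vcomp v i))).
  apply: is_L2_sum => // j; apply: (@is_L2_bounded_mul _ _ _ M) => //.
  - by have [] := La j.
  - by apply: ae_imp aM => x H Ax; exact: H.
  - exact: is_L2_wderiv.
apply/funext => x; rewrite /vcomp mxE fct_sumE.
by apply: eq_bigr => j _; rewrite !mxE.
Qed.

Lemma is_L2v_grad A f : measurable A -> is_L2v A (grad A f).
Proof.
move=> mA i; rewrite (_ : vcomp _ i = wderiv A i f); first exact: is_L2_wderiv.
by apply/funext => x; rewrite /vcomp mxE.
Qed.

Lemma is_L2v_div_stress A B (nu : R) v : measurable B ->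
  is_L2v B (div_stress A nu B v).
Proof.
move=> mB i.
rewrite (_ : vcomp _ i = \sum_j wderiv B j (fun y => 2 * nu * symgrad A v y i j)).
  by apply: is_L2_sum => // j; exact: is_L2_wderiv.
by apply/funext => x; rewrite /vcomp mxE fct_sumE.
Qed.

Lemma L2dotv0 A u : L2dotv A u 0 = 0.
Proof.
rewrite /L2dotv; under eq_Rintegral.
  move=> x _; rewrite (_ : mxdot _ _ = 0); first over.
  by apply: big1 => i _; apply: big1 => j _; rewrite mxE mulr0.
by rewrite /Rintegral integral0.
Qed.

Lemma integrable_mxdot_symgrad A v : measurable A ->
  mu.-integrable A (EFin \o (fun x => mxdot (symgrad A v x) (symgrad A v x))).
Proof.
move=> mA.
rewrite (_ : EFin \o _ = (fun x => \sum_(i < d) \sum_(j < d)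
   (symgrad A v x i j * symgrad A v x i j)%:E)%E); last first.
  apply/funext => x; rewrite /= /mxdot -sumEFin; apply: eq_bigr => i _.
  by rewrite -sumEFin.
apply: integrable_sum => // i _; apply: integrable_sum => // j _.
have L : is_L2 A (fun x => symgrad A v x i j).
  rewrite (_ : (fun x => _) =
    2^-1 *: (wderiv A j (vcomp v i) + wderiv A i (vcomp v j))).
    by apply: is_L2Z => //; apply: is_L2D => //; exact: is_L2_wderiv.
  by apply/funext => x; rewrite /symgrad !mxE.
exact: (is_L2_mul mA L L).
Qed.

End L2_more.

(** * Splitting integrals over the elements of the mesh *)

Section mesh.
Context {R : realType} {d : nat}.
Local Notation mu := (@lebesgue_rV R d).
Context (Om : set 'rV[R]_d) (nel : nat) (el : 'I_nel -> set 'rV[R]_d).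
Hypotheses (oOm : open Om) (el_mesh : is_mesh Om el).

Let mOm : measurable Om. Proof. exact: mx_open_measurable. Qed.

Let mel e : measurable (el e).
Proof. by case: el_mesh => + _ _ _ => /(_ e)[? _]; exact: mx_open_measurable. Qed.

Lemma mesh_sub e : el e `<=` Om.
Proof.
have [oe _ _ ->] := el_mesh; move=> x ex; have [oel _] := oe e.
have : nbhs x (el e) by exact: open_nbhs_nbhs.
by apply: filterS => y ey; exists e => //; exact: subset_closure.
Qed.

Lemma mesh_ae : {ae mu, forall x, Om x -> exists e, el e x}.
Proof.
have [oe _ ce OmE] := el_mesh.
have H e : {ae mu, forall x, ~ (closure (el e) `\` el e) x}.
  exists (closure (el e) `\` el e); split => //; last by move=> x /contrapT.
  apply: measurableD => //; rewrite -[closure _]setCK; apply: measurableC.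
  by apply: mx_open_measurable; rewrite openC; exact: closed_closure.
have cI : countable [set: 'I_nel] by exact/finite_set_countable/finite_finset.
apply: ae_imp (ae_forall_countable cI (fun e _ => H e)) => x Hx Omx.
have : (\bigcup_e closure (el e)) x by apply: interior_subset; rewrite -OmE.
move=> [e _ cex]; have [ex|nex] := pselect (el e x); first by exists e.
by exfalso; apply: (Hx e).
Qed.

Lemma Rintegral_mesh (F : 'rV[R]_d -> R) : mu.-integrable Om (EFin \o F) ->
  \int[mu]_(x in Om) F x = \sum_(e < nel) \int[mu]_(x in el e) F x.
Proof.
move=> iF; have [_ tel _ _] := el_mesh.
have iFe e : mu.-integrable Om ((EFin \o F) \_ (el e)).
  have mI : measurable (Om `&` el e) by exact: measurableI.
  have sub : Om `&` el e `<=` Om by move=> x [].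
  by apply/integrable_restrict => //; exact: (integrableS mOm mI sub iF).
have sumE : (\int[mu]_(x in Om) (F x)%:E =
    \sum_(e < nel) \int[mu]_(x in el e) (F x)%:E)%E.
  (* Almost every point of [Om] lies in an element, and by disjointness in only one, so exactly one
     summand survives there. *)
  transitivity (\int[mu]_(x in Om) (\sum_(e < nel) ((EFin \o F) \_ (el e)) x))%E.
    apply: ae_eq_integral => //; first exact: measurable_int iF.
      by apply: measurable_int; apply: integrable_sum => // e _; exact: iFe.
    apply: ae_imp mesh_ae => x Hx Omx; have [e ex] := Hx Omx.
    rewrite (bigD1 e)//= big1 ?adde0 => [|e' e'e].
      by rewrite patchE mem_set.
    rewrite patchE memNset// => e'x; move/eqP: e'e; apply.
    by apply: (tel e' e I I); exists x.
  rewrite integral_sum//; apply: eq_bigr => e _.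
  by rewrite -integral_mkcondr setIidr//; exact: mesh_sub.
rewrite /Rintegral sumE sum_fine// => e _.
apply: integrable_fin_num => //; apply: integrableS iF => //; exact: mesh_sub.
Qed.

End mesh.

(** * Boundedness of mapped rational functions *)

Section rational.
Context {R : realType} {d : nat}.
Local Notation mu := (@lebesgue_rV R d).

Lemma continuous_polyeval (p : mpoly.mpoly d R) : continuous (polyeval p).
Proof.
have -> : polyeval p = fun y : 'rV[R]_d => \sum_(m <- mpoly.msupp p)
    (mpoly.mcoeff m p * \prod_(i < d) y 0 i ^+ (mpoly.fun_of_multinom m i)).
  by apply/funext => y; rewrite /polyeval mpoly.mevalE.
have cX i k : continuous (fun y : 'rV[R]_d => y 0 i ^+ k).
  move=> x; apply: (@continuous_comp _ _ _
    (fun y : 'rV[R]_d => y 0 i) (fun r => r ^+ k)).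
    exact: coord_continuous.
  exact: exprn_continuous.
move=> x.
apply: (cvg_big (P := xpredT) (@add_continuous R) (nbhs_filter x)) => m _.
apply: cvgM; first exact: cvg_cst.
apply: (cvg_big (P := xpredT) (@mul_continuous R) (nbhs_filter x)) => i _.
exact: cX.
Qed.

Lemma compact_closure_bounded (K : set 'rV[R]_d) :
  bounded_set K -> compact (closure K).
Proof.
move=> [M [Mreal KM]]; apply: bounded_closed_compact; last exact: closed_closure.
exists (M + 1); split => [|N MN x Kx]; first exact: num_real.
have cl : closed [set x : 'rV[R]_d | `|x| <= N].
  apply: (@closed_comp _ _ (fun x : 'rV[R]_d => `|x|) [set r | r <= N]).
    by move=> y _; exact: norm_continuous.
  exact: closed_le.
have KN : K `<=` [set x : 'rV[R]_d | `|x| <= N].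
  by move=> y Ky; apply: (KM N) => //; rewrite (lt_trans _ MN)// ltrDl.
by rewrite closure_id in cl; have := closure_subset KN; rewrite -cl; exact.
Qed.

(** The denominator has no zero on the compact closure of the reference element, so the quotient is
    bounded there, and [G] maps [A] into it. *)
Lemma mapped_rational_bounded (A K : set 'rV[R]_d) G f :
  element_chart A K G -> mapped_rational A K G f ->
  exists M : R, {ae mu, forall x, A x -> `|f x| <= M}.
Proof.
move=> [oK bK GK _] [p [q [q0 fpq]]].
have c : {within closure K, continuous (fun y => polyeval p y / polyeval q y)}.
  apply/continuous_in_subspaceT => y /set_mem Ky.
  apply: cvgM; [exact: nbhs_filter|exact: continuous_polyeval|].
  by apply: cvgV; [exact: nbhs_filter|exact: q0|exact: continuous_polyeval].
have /compact_bounded[M [_ hM]] := continuous_compact c (compact_closure_bounded bK).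
exists (M + 1); apply: ae_imp fpq => x fx Ax; rewrite fx//.
apply: (hM (M + 1)); first by rewrite ltrDl.
exists (G x) => //; apply: subset_closure; rewrite -GK; by exists x.
Qed.

End rational.

(** * Stress estimate, residual and energy balance at one time *)

Section fixed_time.
Context {R : realType} {d : nat}.
Local Notation mu := (@lebesgue_rV R d).
Local Notation vector := ('rV[R]_d -> 'rV[R]_d).
Context (Om : set 'rV[R]_d) (nel : nat) (el K : 'I_nel -> set 'rV[R]_d).
Context (G : 'I_nel -> 'rV[R]_d -> 'rV[R]_d).
Hypotheses (oOm : open Om) (el_mesh : is_mesh Om el).

Let mOm : measurable Om. Proof. exact: mx_open_measurable. Qed.

Let mel e : measurable (el e).
Proof. by case: el_mesh => + _ _ _ => /(_ e)[? _]; exact: mx_open_measurable. Qed.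

Lemma piecewise_rational_bounded (v : vector) :
  (forall e, element_chart (el e) (K e) (G e)) ->
  (forall i, piecewise_rational el K G (vcomp v i)) ->
  exists M : R, {ae mu, forall x, Om x -> forall i, `|v x 0 i| <= M}.
Proof.
move=> chart pw.
have bnd e i := mapped_rational_bounded (chart e) (pw i e).
pose M (e : 'I_nel) (i : 'I_d) : R := sval (cid (bnd e i)).
have HM e i : {ae mu, forall x, el e x -> `|v x 0 i| <= M e i}.
  exact: svalP (cid (bnd e i)).
(* The sum over the finitely many elements and components dominates each single bound; absolute
   values are taken because a bound on a null set may be negative. *)
exists (\sum_e \sum_i `|M e i|).
have ceI : countable [set: 'I_nel * 'I_d].
  exact/finite_set_countable/finite_finset.
have H1 := ae_forall_countable ceI (fun q _ => HM q.1 q.2).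
have := ae_and (mesh_ae el_mesh) H1; apply: ae_imp => x [Hx HMx] Omx i.
have [e ex] := Hx Omx.
apply: le_trans (HMx (e, i) I ex) _; apply: le_trans (ler_norm _) _.
rewrite (bigD1 e)//= (bigD1 i)//= -addrA lerDl addr_ge0//.
  by apply: sumr_ge0.
by apply: sumr_ge0 => e' _; apply: sumr_ge0.
Qed.

Lemma L2dotv_mesh (v w : vector) : is_L2v Om v -> is_L2v Om w ->
  L2dotv Om v w = \sum_(e < nel) L2dotv (el e) v w.
Proof.
by move=> Lv Lw; apply: Rintegral_mesh => //; exact: integrable_mxdot.
Qed.

Lemma is_L2v_invZ (tau : 'rV[R]_d -> R) (M : R) (w : vector) :
  measurable_fun Om tau -> (forall x, Om x -> 0 < tau x /\ (tau x)^-1 <= M) ->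
  is_L2v Om w -> is_L2v Om (fun x => (tau x)^-1 *: w x).
Proof.
move=> mtau tauM Lw i.
rewrite (_ : vcomp _ i = (fun x => (tau x)^-1) \* vcomp w i); last first.
  by apply/funext => x; rewrite /vcomp mxE.
apply: (@is_L2_bounded_mul _ _ _ _ _ M) => //.
(* As [tau] is positive on [Om], its inverse coincides there with the real power of exponent -1,
   which is a measurable function. *)
- apply: (@eq_measurable_fun _ _ _ _ _ (fun x => tau x `^ (-1))).
    by move=> x /set_mem/tauM[t0 _]; rewrite powR_inv1// ltW.
  exact: (measurableT_comp (measurable_powR _)).
- apply: aeW => x /tauM[t0 tM]; rewrite ger0_norm// invr_ge0 ltW//.
Qed.

Lemma div_stress_young (nu Cinv : R) (e : 'I_nel) (v w : vector)
    (tau : 'rV[R]_d -> R) :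
  0 < nu -> 0 < Cinv ->
  L2dotv (el e) (div_stress Om nu (el e) v) (div_stress Om nu (el e) v) <=
    Cinv / diam (el e) ^+ 2 *
    L2dotmx (el e) (fun x => nu *: symgrad Om v x) (fun x => nu *: symgrad Om v x) ->
  (forall x, el e x -> 0 < tau x /\ tau x <= diam (el e) ^+ 2 / (Cinv * nu)) ->
  is_L2v (el e) w -> is_L2v (el e) (fun x => (tau x)^-1 *: w x) ->
  L2dotv (el e) (div_stress Om nu (el e) v) w <=
  2^-1 * L2dotv (el e) (fun x => (tau x)^-1 *: w x) w +
  2^-1 * (nu * \int[mu]_(x in el e) mxdot (symgrad Om v x) (symgrad Om v x)).
Proof.
move=> nu0 C0 inv tauP Lw Ltw.
set S := div_stress _ _ _ _; set h2 := diam (el e) ^+ 2.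
pose c := h2 / (Cinv * nu).
(* Positivity of the diameter is read off (ii): the element is nonempty and 0 < tau <= c at any of
   its points, while a zero diameter would give c = 0. *)
have h20 : 0 < h2.
  have [oe _ _ _] := el_mesh; have [_ [x ex]] := oe e.
  have [t0 tc] := tauP _ ex; have : 0 < c by exact: lt_le_trans tc.
  by rewrite /c pmulr_lgt0// invr_gt0 mulr_gt0.
have LS : is_L2v (el e) S by exact: is_L2v_div_stress.
have iS := integrable_mxdot (mel e) LS LS.
have iw := integrable_mxdot (mel e) Ltw Lw.
(* Young's inequality is pointwise with the variable weight [tau]. In the stress term [tau] is
   replaced at once by its constant bound [c], because the inverse estimate (i) only controls the
   unweighted integral. *)
have H : L2dotv (el e) S w <=
    2^-1 * L2dotv (el e) (fun x => (tau x)^-1 *: w x) w +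
    2^-1 * c * L2dotv (el e) S S.
  have iw2 : mu.-integrable (el e)
      (EFin \o (fun x => 2^-1 * mxdot ((tau x)^-1 *: w x) (w x))).
    exact: integrableZl iw.
  have iS2 : mu.-integrable (el e) (EFin \o (fun x => 2^-1 * c * mxdot (S x) (S x))).
    exact: integrableZl iS.
  rewrite /L2dotv -(RintegralZl _ (mel e) iw) -(RintegralZl _ (mel e) iS).
  rewrite -(RintegralD (mel e) iw2 iS2); apply: le_Rintegral => //.
  - exact: integrable_mxdot.
  - exact: integrableD iw2 iS2.
  move=> x ex; have [t0 tc] := tauP _ ex.
  rewrite mxdotZl !mxdotE !mulr_sumr -big_split/=; apply: ler_sum => j _.
  move: (S x 0 j) (w x 0 j) => a b.
  (* 2 a b <= tau a^2 + b^2 / tau *)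
  have : 0 <= (tau x * a - b) ^+ 2 by exact: sqr_ge0.
  have : tau x * a ^+ 2 <= c * a ^+ 2 by rewrite ler_wpM2r ?sqr_ge0.
  move=> H1; rewrite -(pmulr_rge0 _ (_ : 0 < (tau x)^-1)) ?invr_gt0//.
  have -> : (tau x)^-1 * (tau x * a - b) ^+ 2 =
    tau x * a ^+ 2 - 2 * a * b + (tau x)^-1 * b ^+ 2 by field; rewrite gt_eqF.
  by rewrite !expr2 in H1 *; lra.
apply: le_trans H _; rewrite lerD2l -mulrA ler_wpM2l//.
apply: le_trans (ler_wpM2l _ inv) _.
  by rewrite divr_ge0 ?ltW// mulr_gt0.
have -> : L2dotmx (el e) (fun x => nu *: symgrad Om v x)
    (fun x => nu *: symgrad Om v x) = nu ^+ 2 * \int[mu]_(x in el e) mxdot (symgrad Om v x) (symgrad Om v x).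
  rewrite -RintegralZl//.
    by apply: eq_Rintegral => x _; rewrite mxdotZl mxdotC mxdotZl mulrA expr2.
  by apply: integrableS (integrable_mxdot_symgrad v mOm) => //; exact: mesh_sub.
(* The constants of (i) and (ii) match exactly: [c * (Cinv / h2) * nu ^+ 2 = nu]. *)
rewrite /c -/h2 mulrA le_eqVlt; apply/orP; left; apply/eqP.
set J := \int[mu]_(x in _) _.
by field; rewrite !gt_eqF.
Qed.

(** Linearity of the integral needs every summand in L^2, which is where the convective term must be
    square-integrable. The stress stays a sum over elements, since its outer divergence is weak only
    inside each of them. *)
Lemma residual_dotE (nu : R) (f dtuh uh w : vector) (ph : 'rV[R]_d -> R) :
  is_L2v Om dtuh -> is_L2v Om (advect Om uh uh) -> is_L2v Om f -> is_L2v Om w ->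
  residual_dot Om nu el dtuh uh ph f w =
  L2dotv Om dtuh w + L2dotv Om (advect Om uh uh) w + L2dotv Om (grad Om ph) w
  - L2dotv Om f w - \sum_(e < nel) L2dotv (el e) (div_stress Om nu (el e) uh) w.
Proof.
move=> Ld La Lf Lw; have Lg := is_L2v_grad ph mOm.
rewrite !L2dotv_mesh// -!big_split/= -!sumrB; apply: eq_bigr => e _.
have sub := mesh_sub el_mesh (e := e).
have LS := is_L2v_div_stress Om nu uh (mel e).
have {}Ld := is_L2vS mOm (mel e) sub Ld.
have {}La := is_L2vS mOm (mel e) sub La.
have {}Lf := is_L2vS mOm (mel e) sub Lf.
have {}Lw := is_L2vS mOm (mel e) sub Lw.
have {}Lg := is_L2vS mOm (mel e) sub Lg.
have -> : residual Om nu (el e) dtuh uh ph f =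
    (((dtuh + advect Om uh uh) - div_stress Om nu (el e) uh) + grad Om ph) - f by [].
have me := mel e.
have L1 := is_L2vD me Ld La; have L2 := is_L2vB me L1 LS.
have L3 := is_L2vD me L2 Lg.
rewrite (L2dotvBl me L3 Lf Lw) (L2dotvDl me L2 Lg Lw) (L2dotvBl me L1 LS Lw).
by rewrite (L2dotvDl me Ld La Lw); ring.
Qed.

Lemma energy_balance_le (nu Cinv M Mtau : R) (tauC tauM : 'rV[R]_d -> R)
    (f uh dtuh uf dtuf : vector) (ph pf : 'rV[R]_d -> R) :
  0 < nu -> 0 < Cinv ->
  is_L2v Om f -> is_L2v Om uh -> is_L2v Om dtuh -> is_L2v Om uf -> is_L2v Om dtuf ->
  {ae mu, forall x, Om x -> forall i, `|uh x 0 i| <= M} ->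
  measurable_fun Om tauM ->
  (forall x, Om x -> 0 < tauM x /\ (tauM x)^-1 <= Mtau) ->
  (forall e, L2dotv (el e) (div_stress Om nu (el e) uh) (div_stress Om nu (el e) uh)
    <= Cinv / diam (el e) ^+ 2 * L2dotmx (el e) (fun x => nu *: symgrad Om uh x)
                                   (fun x => nu *: symgrad Om uh x)) ->
  (forall e x, el e x -> tauM x <= diam (el e) ^+ 2 / (Cinv * nu)) ->
  coarse_eq Om nu tauC f uh dtuh ph uf dtuf uh ph ->
  fine_eq Om nu el tauM f uh dtuh ph uf dtuf pf uf pf ->
  fine_eq Om nu el tauM f uh dtuh ph uf dtuf pf 0 ph ->
  L2dotv Om (dtuh + dtuf) (uh + uf) <=
    L2dotv Om f (uh + uf) - 2^-1 * form_k Om nu uh uh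
    - L2dot Om (fun x => tauC x * divergence Om uh x) (divergence Om uh)
    - 2^-1 * L2dotv Om (fun x => (tauM x)^-1 *: uf x) uf.
Proof.
move=> nu0 C0 Lf Luh Ld Luf Ldf uhM mtau tauP inv tau_le coarse fine fine0.
have La := is_L2v_advect uh mOm Luh uhM.
have Lt := is_L2v_invZ mtau tauP Luf.
have L0 := is_L2v0 mOm.
(* Qh is included in Qf: test the fine-scale problem with (0, ph). *)
have gph0 : L2dotv Om (grad Om ph) uf = 0.
  move: fine0; rewrite /fine_eq residual_dotE// /form_c !L2dotv0.
  rewrite [X in _ = - (_ - X)]big1 => [|e _]; last exact: L2dotv0.
  by move=> /eqP; rewrite !(addr0, add0r, subr0, oppr0) oppr_eq0 => /eqP.
pose J := \int[mu]_(x in Om) mxdot (symgrad Om uh x) (symgrad Om uh x).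
have iJ := integrable_mxdot_symgrad uh mOm.
have J0 : 0 <= J by apply: Rintegral_ge0 => x _; exact: mxdot_ge0.
have kE : form_k Om nu uh uh = 2 * nu * J by rewrite /form_k RintegralZl.
pose P := L2dotv Om (fun x => (tauM x)^-1 *: uf x) uf.
pose S := \sum_(e < nel) L2dotv (el e) (div_stress Om nu (el e) uh) uf.
have SE : S <= 2^-1 * P + 2^-1 * (nu * J).
  rewrite /P L2dotv_mesh// /J (Rintegral_mesh oOm el_mesh iJ) !mulr_sumr.
  rewrite -big_split/=.
  apply: ler_sum => e _; have sub := mesh_sub el_mesh (e := e).
  apply: (div_stress_young nu0 C0 (inv e)).
  - by move=> x ex; split; [have [] := tauP _ (sub _ ex)|exact: tau_le].
  - exact: is_L2vS Luf.
  - exact: is_L2vS Lt.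
move: coarse fine; rewrite /coarse_eq /fine_eq residual_dotE//.
rewrite /form_cskew /form_c /form_ccons -/P -/S gph0.
(* Symmetry of the pairing holds without any integrability. It makes both skew terms vanish and lets
   the two conservative terms of the coarse equation cancel against the convective terms of the fine
   one, although u'·∇u^h is not known to be in L^2. *)
rewrite (L2dotvC Om uh (advect Om uh uh)) (L2dotvC Om uh (advect Om uf uh)).
rewrite (L2dotvC Om uf (advect Om uh uh)) (L2dotvC Om uf (advect Om uf uh)).
rewrite !subrr !mulr0 kE.
rewrite (L2dotvDl mOm Ld Ldf (is_L2vD mOm Luh Luf)).
rewrite (L2dotvDr mOm Luh Luf Ld) (L2dotvDr mOm Luh Luf Ldf).
rewrite (L2dotvDr mOm Luh Luf Lf).
(* With k(u^h, u^h) = 2 nu J, Young's inequality spends k / 4, leaving -3k / 4; nonnegativity lets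
   the surplus k / 4 be discarded to reach -k / 2. *)
have nuJ : 0 <= nu * J by rewrite mulr_ge0// ltW.
rewrite -[2 * nu * J]mulrA.
move: (nu * J) P S nuJ SE => X P S X0 SE E1 E2.
move: (L2dotv Om dtuh uh) (L2dotv Om dtuh uf) (L2dotv Om dtuf uh) (L2dotv Om dtuf uf)
  (L2dotv Om (advect Om uh uh) uf) (L2dotv Om (advect Om uf uh) uf)
  (L2dotv Om f uh) (L2dotv Om f uf) (L2dotv Om (grad Om pf) uf)
  (form_b Om uh ph) (L2dot Om _ _) E1 E2
  => a1 a2 a3 a4 a5 a6 a7 a8 a9 a10 a11 E1 E2.
by move: X0 SE E1 E2; clear; lra.
Qed.

End fixed_time.

Unset Implicit Arguments.
Set Strict Implicit.

Theorem lemma2 (R : realType) (d : nat) (d_gt0 : (0 < d)%N)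
  (* domain, time interval, viscosity, source term *)
  (Om : set 'rV[R]_d) (Om_domain : bounded_domain Om)
  (T : R) (T_gt0 : 0 < T) (nu : R) (nu_gt0 : 0 < nu)
  (f : R -> 'rV[R]_d -> 'rV[R]_d)
  (f_L2 : {ae @lebesgue_measure R,
     forall t : R, t \in `]0, T[ -> is_L2v Om (f t)})
  (* mesh, with element el e, reference element K e and inverse mapping G e *)
  (nel : nat) (el K : 'I_nel -> set 'rV[R]_d)
  (G : 'I_nel -> 'rV[R]_d -> 'rV[R]_d)
  (el_mesh : is_mesh Om el)
  (el_chart : forall e, element_chart (el e) (K e) (G e))
  (* coarse-scale velocity and pressure spaces *)
  (Vh : set ('rV[R]_d -> 'rV[R]_d)) (Qh : set ('rV[R]_d -> R))
  (Vh_space : findim_space Om Vh (is_H10v Om))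
  (Qh_space : findim_space Om Qh (is_L20 Om `&` is_H1 Om))
  (Vh_pw : forall v, Vh v -> forall i, piecewise_rational el K G (vcomp v i))
  (Qh_pw : forall q, Qh q -> piecewise_rational el K G q)
  (VhQh_stable : inf_sup_stable Om Vh Qh)
  (* fine-scale pressure space *)
  (Qf : set ('rV[R]_d -> R))
  (Qf_space : findim_space Om Qf (is_H1 Om))
  (Qh_sub_Qf : Qh `<=` Qf)
  (* stabilization parameters *)
  (tauC tauM : R -> 'rV[R]_d -> R)
  (tau_meas : forall t, t \in `]0, T[ ->
     measurable_fun Om (tauC t) /\ measurable_fun Om (tauM t))
  (tauC_ge0 : forall t x, t \in `]0, T[ -> Om x -> 0 <= tauC t x)
  (tauM_gt0 : forall t x, t \in `]0, T[ -> Om x -> 0 < tauM t x)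
  (tau_bnd : forall t, t \in `]0, T[ ->
     exists M : R, forall x, Om x -> tauC t x <= M /\ (tauM t x)^-1 <= M)
  (* assumptions (i) and (ii) *)
  (Cinv : R) (Cinv_gt0 : 0 < Cinv)
  (inv_est : inverse_estimate Om nu Cinv el Vh)
  (tauM_le : forall e t x, t \in `]0, T[ -> el e x ->
     tauM t x <= diam (el e) ^+ 2 / (Cinv * nu))
  (* solution of the semi-discrete problem, with time derivatives *)
  (uh0 uf0 : 'rV[R]_d -> 'rV[R]_d) (uh0_Vh : Vh uh0) (uf0_L2 : is_L2v Om uf0)
  (uh dtuh : R -> 'rV[R]_d -> 'rV[R]_d) (ph : R -> 'rV[R]_d -> R)
  (uf dtuf : R -> 'rV[R]_d -> 'rV[R]_d) (pf : R -> 'rV[R]_d -> R)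
  (uh_VhT : in_VhT Om T Vh uh dtuh) (ph_QhT : in_QT Om T Qh ph)
  (uf_VfT : in_VfT Om T uf dtuf) (pf_QfT : in_QT Om T Qf pf)
  (uh_init : ae_eq (lebesgue_rV R d) Om (uh 0) uh0)
  (uf_init : ae_eq (lebesgue_rV R d) Om (uf 0) uf0)
  (coarse : {ae @lebesgue_measure R, forall t : R, t \in `]0, T[ ->
     forall vh qh, Vh vh -> Qh qh ->
     coarse_eq Om nu (tauC t) (f t) (uh t) (dtuh t) (ph t) (uf t) (dtuf t)
       vh qh})
  (fine : {ae @lebesgue_measure R, forall t : R, t \in `]0, T[ ->
     forall vf qf, is_L2v Om vf -> Qf qf ->
     fine_eq Om nu el (tauM t) (f t) (uh t) (dtuh t) (ph t) (uf t) (dtuf t)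
       (pf t) vf qf}) :
  let u t := uh t + uf t in
  let energy (t : R) := 2^-1 * L2normv Om (u t) ^+ 2 in
  {ae @lebesgue_measure R, forall t : R, t \in `]0, T[ ->
     derivable energy t 1 /\
     'D_1 energy t <=
       L2dotv Om (f t) (u t) - 2^-1 * form_k Om nu (uh t) (uh t)
       - L2dot Om (fun x => tauC t x * divergence Om (uh t) x)
                  (divergence Om (uh t))
       - 2^-1 * L2dotv Om (fun x => (tauM t x)^-1 *: uf t x) (uf t)} /\
  ({ae @lebesgue_measure R, forall t : R, t \in `]0, T[ ->
      ae_eq (lebesgue_rV R d) Om (f t) (fun=> 0)} ->
   forall s t : R, 0 <= s -> s <= t -> t <= T -> energy t <= energy s).

Proof.
move=> u energy.
have [oOm _ _ _] := Om_domain.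
have mOm : measurable Om by exact: mx_open_measurable.
have VhH : Vh `<=` is_H10v Om by have [n [phi [_ ->]]] := Vh_space; move=> v [].
have VhL : Vh `<=` is_L2v Om by move=> v /VhH Hv i; have [[]] := Hv i.
have uh_VfT := in_VhT_in_VfT mOm VhL uh_VhT.
have [uhC [dtuhV _ _] _] := uh_VhT.
have [phQ _ _] := ph_QhT; have [pfQ _ _] := pf_QfT.
have [ufC [dtufL _ _] _] := uf_VfT.
(* In [coarse] and [fine] the test functions are quantified inside the almost-everywhere statement,
   so test functions depending on [t], such as [uh t] and [uf t], are admissible outside one null
   set. *)
have bound : {ae @lebesgue_measure R, forall t : R, t \in `]0, T[ ->
    L2dotv Om (dtuh t + dtuf t) (u t) <=
    L2dotv Om (f t) (u t) - 2^-1 * form_k Om nu (uh t) (uh t)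
    - L2dot Om (fun x => tauC t x * divergence Om (uh t) x) (divergence Om (uh t))
    - 2^-1 * L2dotv Om (fun x => (tauM t x)^-1 *: uf t x) (uf t)}.
  apply: ae_imp (ae_and f_L2 (ae_and coarse fine)) => t [ft [ct nt]] tT.
  have tT' : t \in `[0, T] by exact: subset_itv_oo_cc tT.
  have [Vuh _] := uhC t tT'; have [Luf _] := ufC t tT'.
  have [M HM] := piecewise_rational_bounded el_mesh el_chart (Vh_pw _ Vuh).
  have [Mtau HMtau] := tau_bnd _ tT.
  have [_ mtau] := tau_meas _ tT.
  apply: (energy_balance_le oOm el_mesh nu_gt0 Cinv_gt0 (ft tT) (VhL _ Vuh)
    (VhL _ (dtuhV _ tT)) Luf (dtufL _ tT) HM mtau (Mtau := Mtau)).
  - by move=> x Omx; split; [exact: tauM_gt0|have [] := HMtau _ Omx].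
  - by move=> e; exact: inv_est.
  - by move=> e x; exact: tauM_le.
  - by apply: ct => //; exact: phQ.
  - by apply: nt => //; exact: pfQ.
  - by apply: nt => //; [exact: is_L2v0|exact/Qh_sub_Qf/phQ].
split.
  apply: ae_imp (ae_and bound (ae_energy_derivative mOm uh_VfT uf_VfT)).
  move=> t [bt Et] tT; have [dE DE] := Et tT.
  by split => //; rewrite DE; exact: bt.
move=> f0; apply: (energy_nonincreasing mOm uh_VfT uf_VfT).
apply: ae_imp (ae_and f_L2 (ae_and f0 bound)) => t [ft [ft0 bt]] tT.
apply: le_trans (bt tT) _.
have tT' : t \in `[0, T] by exact: subset_itv_oo_cc tT.
have [Vuh _] := uhC t tT'; have [Luf _] := ufC t tT'.
have Lu : is_L2v Om (u t) by apply: is_L2vD => //; exact: VhL.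
(* The source vanishes only almost everywhere in space, so its pairing is compared with the pairing
   against the zero field; what remains of the bound is minus a sum of nonnegative terms. *)
have -> : L2dotv Om (f t) (u t) = 0.
  rewrite L2dotvC; transitivity (L2dotv Om (u t) 0); last exact: L2dotv0.
  congr (constructive_ereal.fine _).
  apply: ae_eq_integral => //.
  - exact: measurable_int (integrable_mxdot mOm Lu (ft tT)).
  - exact: measurable_int (integrable_mxdot mOm Lu (is_L2v0 mOm)).
  - by apply: ae_imp (ft0 tT) => x fx Omx; rewrite fx.
have k0 : 0 <= form_k Om nu (uh t) (uh t).
  by apply: Rintegral_ge0 => x _; rewrite !mulr_ge0 ?mxdot_ge0// ltW.
have C0 : 0 <= L2dot Om (fun x => tauC t x * divergence Om (uh t) x)
    (divergence Om (uh t)).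
  apply: Rintegral_ge0 => x Omx; rewrite -mulrA mulr_ge0 ?tauC_ge0//.
  by rewrite -expr2 sqr_ge0.
have P0 : 0 <= L2dotv Om (fun x => (tauM t x)^-1 *: uf t x) (uf t).
  apply: Rintegral_ge0 => x Omx; rewrite mxdotZl mulr_ge0 ?mxdot_ge0//.
  by rewrite invr_ge0 ltW// tauM_gt0.
by move: k0 C0 P0; clear; lra.
Qed.
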